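(* Let $d\ge 1$ and $n\ge d+2$ be integers with $(d,n)\neq(2,4)$. Then every linear automorphism ${\bf A}$ of $L_{d,n}$ is a scalar multiple of a signed permutation induced by a vertex relabeling; that is, ${\bf A}=c\,{\bf S}{\bf P}$ for some $c\in\mathbb C\setminus\{0\}$, some diagonal matrix ${\bf S}$ with diagonal entries in $\{1,-1\}$, and some permutation matrix ${\bf P}$ that maps each coordinate vector $e_{\{i,j\}}$ to $e_{\{\sigma(i),\sigma(j)\}}$ for a fixed permutation $\sigma$ of $\{1,\dots,n\}$.
   Context: Let $N=\binom{n}{2}$ and index the coordinates of $\mathbb C^N$ by the edges $\{i,j\}$ ($1\le i<j\le n$) of the complete graph $K_n$. For a complex configuration ${\bf p}=({\bf p}_1,\dots,{\bf p}_n)$ of points in $\mathbb C^d$, let $m({\bf p})\in\mathbb C^N$ have coordinates $m_{ij}({\bf p})=\sum_{k=1}^d({\bf p}_i^k-{\bf p}_j^k)^2$ (no complex conjugation). The squared measurement variety $M_{d,n}\subset\mathbb C^N$ is the image of $m$ over all complex configurations. Let $s:\mathbb C^N\to\mathbb C^N$ square each coordinate; the unsquared measurement variety is $L_{d,n}=s^{-1}(M_{d,n})$. A linear automorphism of a variety $V\subset\mathbb C^N$ is a non-singular $N\times N$ complex matrix ${\bf A}$ mapping $V$ bijectively onto itself. *)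

(* Defs.v *)
From HB Require Import structures.
From mathcomp Require Import all_boot all_order all_algebra all_fingroup.
From mathcomp Require Import complex.
From mathcomp Require Import reals.
Set Implicit Arguments. Unset Strict Implicit. Unset Printing Implicit Defensive.
Import Order.TTheory GRing.Theory Num.Theory.
Local Open Scope ring_scope.

Definition edge (n : nat) := {p : 'I_n * 'I_n | (p.1 < p.2)%N}.

(* N = binom(n,2) = number of edges; coordinates of C^N are indexed by 'I_N
   through the enumeration of edges (enum_val / enum_rank). *)
Definition nedges (n : nat) : nat := #|{: edge n}|.

Definition edge_of (n : nat) (k : 'I_(nedges n)) : edge n := enum_val k.

Definition edge_set (n : nat) (e : edge n) : {set 'I_n} :=
  [set (val e).1; (val e).2].

Section Measure.
Variable C : fieldType.

(* m(p): squared edge lengths (no conjugation) of a configuration p of n points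
   in C^d (row i of p is the point p_i). *)
Definition meas (d n : nat) (p : 'M[C]_(n, d)) : 'cV[C]_(nedges n) :=
  \col_k \sum_(l < d)
     (p (val (edge_of k)).1 l - p (val (edge_of k)).2 l) ^+ 2.

Definition Mvar (d n : nat) : 'cV[C]_(nedges n) -> Prop :=
  fun x => exists p : 'M[C]_(n, d), x = meas p.

Definition sqmap (N : nat) (x : 'cV[C]_N) : 'cV[C]_N := map_mx (fun a => a ^+ 2) x.

Definition Lvar (d n : nat) : 'cV[C]_(nedges n) -> Prop :=
  fun x => @Mvar d n (sqmap x).

Definition lin_automorphism (N : nat) (V : 'cV[C]_N -> Prop) (A : 'M[C]_N) : Prop :=
  A \in unitmx /\
  (forall x, V x -> V (A *m x)) /\
  (forall y, V y -> exists x, V x /\ A *m x = y).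

Definition edge_perm_mx (n : nat) (sigma : 'S_n) : 'M[C]_(nedges n) :=
  \matrix_(k, l) (edge_set (edge_of k) == [set sigma x | x in edge_set (edge_of l)])%:R.

End Measure.

Arguments Mvar {C} d n _.
Arguments Lvar {C} d n _.
Arguments edge_perm_mx {C n} sigma.

(* Main.v *)
(* A polynomial h of degree 2d+2 vanishing on L_{d,n} splits, by the characters of
   the coordinate sign changes, into terms x^T g_T(x^2) with g_T vanishing on
   M_{d,n}. A polynomial of degree <= r vanishing on M_{r,n} is zero (take
   differences along M_{1,n}, which spans C^N), so only T empty survives: h(x) =
   g(x^2). The same principle shows that g, hence h, is quadratic along every
   direction y that is a signed star, i.e. has coordinates +-1 on the edges at
   one vertex and 0 elsewhere. Applied to h = f o A with f a Gram minor, this says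
   that f is quadratic along A y; for d >= 2 this forces A y to be a multiple of
   a signed star. For n >= 5, comparing the stars at one vertex that differ by one
   or two signs shows that A carries the span of the stars at i to the span of the
   stars at some sigma(i), so A maps the line of e_ij to that of
   e_{sigma(i) sigma(j)}, with factors of constant square.

   For d = 1 the Heron polynomial of a triangle is a product of four linear forms.
   Its pullback by A is even in every coordinate, so the four pulled-back forms are
   permuted up to scalars by the sign changes, and one of them vanishes on the
   linear space {(p_i - p_j)}. Hence they are again the four forms of a triangle,
   and A permutes the coordinates up to factors, mapping triangles to triangles. *)
Require Import Defs.
From HB Require Import structures.
From mathcomp Require Import all_boot all_order all_algebra all_fingroup.
From mathcomp Require Import complex.
From mathcomp Require Import reals.
From mathcomp Require Import ring zify.
Set Implicit Arguments. Unset Strict Implicit. Unset Printing Implicit Defensive.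
Import Order.TTheory GRing.Theory Num.Theory.
Local Open Scope ring_scope.

(** Everything rests on a tight degree count. A Gram minor of order d+1 has degree d+1 in the
    squared coordinates, one more than the largest degree at which vanishing on M_{d,n} forces zero,
    so any operation that lowers the degree and keeps the vanishing kills it. Along a star direction
    the squared coordinates follow a curve x^2 + s b + s^2 c. The coefficient of s^m has lost at
    least m/2 degrees, rounded up, hence two for m >= 3, while the moving rank one part uses up one
    dimension: what is left has degree at most d-1 and vanishes on a translate of M_{d-1,n}.
    Polynomials occur only as functions, so being quadratic along y is recorded as the vanishing of
    third differences. The test configurations reduce a minor to a 3 x 3 determinant, which needs d
    >= 2; this is why d = 1 has its own argument. For d >= 2 the exclusion of (2,4) leaves n >= 5,
    and the fifth vertex is what the comparison of stars needs. *)

(** * Polynomial functions with a degree bound *)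

Section PolynomialFunctions.
Variables (C : numClosedFieldType) (N : nat).
Implicit Types (f g h : 'cV[C]_N -> C) (x y : 'cV[C]_N) (P : {poly C}).

(* Polynomial functions of degree < k; degree < 0 means identically zero. *)
Inductive poly_lt : nat -> ('cV[C]_N -> C) -> Prop :=
| PolyLt0 k : poly_lt k (fun=> 0)
| PolyLtC k c : poly_lt k.+1 (fun=> c)
| PolyLtD k f g : poly_lt k f -> poly_lt k g -> poly_lt k (fun x => f x + g x)
| PolyLtX k e f : poly_lt k f -> poly_lt k.+1 (fun x => x e 0 * f x)
| PolyLtE k f g : poly_lt k f -> f =1 g -> poly_lt k g.

Lemma poly_lt_zero f x : poly_lt 0 f -> f x = 0.
Proof.
move Dk: 0%N => k fP; elim: fP Dk => //= {f k}.
  by move=> k f g _ IHf _ IHg Dk; rewrite IHf ?IHg ?addr0.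
by move=> k f g _ IHf fg Dk; rewrite -fg IHf.
Qed.

Lemma poly_lt_leq k l f : (k <= l)%N -> poly_lt k f -> poly_lt l f.
Proof.
move=> kl fP; elim: fP l kl => {f k}.
- by move=> k l _; apply: PolyLt0.
- by move=> k c [//|l] _; apply: PolyLtC.
- by move=> k f g _ IHf _ IHg l kl; apply: PolyLtD; [apply: IHf|apply: IHg].
- by move=> k e f _ IHf [//|l] kl; apply: PolyLtX; apply: IHf.
- by move=> k f g _ IHf fg l kl; apply: PolyLtE fg; apply: IHf.
Qed.

Lemma poly_ltZ k c f : poly_lt k f -> poly_lt k (fun x => c * f x).
Proof.
move=> fP; elim: fP => {f k}.
- by move=> k; apply: PolyLtE (PolyLt0 k) _ => x; rewrite mulr0.
- by move=> k a; apply: PolyLtC.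
- move=> k f g _ IHf _ IHg; apply: PolyLtE (PolyLtD IHf IHg) _ => x.
  by rewrite mulrDr.
- move=> k e f _ IHf; apply: PolyLtE (PolyLtX e IHf) _ => x.
  by rewrite mulrCA.
- by move=> k f g _ IHf fg; apply: PolyLtE IHf _ => x; rewrite fg.
Qed.

Lemma poly_ltB k f g :
  poly_lt k f -> poly_lt k g -> poly_lt k (fun x => f x - g x).
Proof.
move=> fP gP; apply: PolyLtE (PolyLtD fP (poly_ltZ (-1) gP)) _ => x.
by rewrite mulN1r.
Qed.

Lemma poly_lt_sum k (I : Type) (r : seq I) (F : I -> 'cV[C]_N -> C) :
  (forall i, poly_lt k (F i)) -> poly_lt k (fun x => \sum_(i <- r) F i x).
Proof.
move=> FP; elim: r => [|i r IH].
  by apply: PolyLtE (PolyLt0 k) _ => x; rewrite big_nil.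
by apply: PolyLtE (PolyLtD (FP i) IH) _ => x; rewrite big_cons.
Qed.

Lemma poly_ltM k l f g :
  poly_lt k f -> poly_lt l.+1 g -> poly_lt (k + l) (fun x => f x * g x).
Proof.
move=> fP gP; elim: fP => {f k}.
- by move=> k; apply: PolyLtE (PolyLt0 _) _ => x; rewrite mul0r.
- move=> k c; apply: poly_ltZ; apply: poly_lt_leq gP; lia.
- move=> k f f' _ IHf _ IHg; apply: PolyLtE (PolyLtD IHf IHg) _ => x.
  by rewrite mulrDl.
- move=> k e f _ IHf; rewrite addSn; apply: PolyLtE (PolyLtX e IHf) _ => x.
  by rewrite mulrA.
- by move=> k f f' _ IHf fg; apply: PolyLtE IHf _ => x; rewrite fg.
Qed.

Lemma poly_lt_prod l (I : Type) (r : seq I) (F : I -> 'cV[C]_N -> C) :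
  (forall i, poly_lt l.+1 (F i)) ->
  poly_lt (size r * l).+1 (fun x => \prod_(i <- r) F i x).
Proof.
move=> FP; elim: r => [|i r IH].
  by apply: PolyLtE (PolyLtC _ 1) _ => x; rewrite big_nil.
rewrite /= mulSn -addnS addnC; apply: PolyLtE (poly_ltM IH (FP i)) _ => x.
by rewrite big_cons mulrC.
Qed.

Lemma poly_lt_coord e : poly_lt 2 (fun x => x e 0).
Proof.
by apply: PolyLtE (PolyLtX e (PolyLtC 0 1)) _ => x; rewrite mulr1.
Qed.

Lemma poly_lt_det l m (F : 'I_m -> 'I_m -> 'cV[C]_N -> C) :
  (forall i j, poly_lt l.+1 (F i j)) ->
  poly_lt (m * l).+1 (fun x => \det (\matrix_(i, j) F i j x)).
Proof.
move=> FP; apply: PolyLtE (_ : poly_lt _ (fun x => \sum_(s : 'S_m)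
   (-1) ^+ s * \prod_i F i (s i) x)) _; last first.
  by move=> x; apply: eq_bigr => s _; congr (_ * _); apply: eq_bigr => i _;
     rewrite !mxE.
apply: poly_lt_sum => s; apply: poly_ltZ.
have := poly_lt_prod (enum 'I_m) (fun i => FP i (s i)).
by rewrite size_enum_ord => /PolyLtE; apply => x; rewrite big_enum.
Qed.

Lemma poly_lt_mulmx k f (A : 'M[C]_N) :
  poly_lt k f -> poly_lt k (fun x => f (A *m x)).
Proof.
move=> fP; elim: fP => {f k}.
- by move=> k; apply: PolyLt0.
- by move=> k c; apply: PolyLtC.
- by move=> k f g _ IHf _ IHg; apply: PolyLtD.
- move=> k e f _ IHf; rewrite -addn1.
  have linP : poly_lt 2 (fun x => (A *m x) e 0).
    apply: PolyLtE (poly_lt_sum (index_enum 'I_N)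
      (fun j => poly_ltZ (A e j) (poly_lt_coord j))) _ => x.
    by rewrite mxE.
  by apply: PolyLtE (poly_ltM IHf linP) _ => x; rewrite mulrC.
- by move=> k f g _ IHf fg; apply: PolyLtE IHf _ => x; rewrite fg.
Qed.

Lemma poly_lt_diff k f y :
  poly_lt k f -> poly_lt k.-1 (fun x => f (x + y) - f x).
Proof.
move=> fP; elim: fP => {f k}.
- by move=> k; apply: PolyLtE (PolyLt0 _) _ => x; rewrite subrr.
- by move=> k c; apply: PolyLtE (PolyLt0 _) _ => x; rewrite subrr.
- move=> k f g _ IHf _ IHg; apply: PolyLtE (PolyLtD IHf IHg) _ => x.
  by rewrite opprD addrACA.
- move=> k e f fP IHf /=.
  have shP : poly_lt k (fun x => f (x + y)).
    apply: PolyLtE (PolyLtD (poly_lt_leq (leq_pred k) IHf) fP) _ => x.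
    by rewrite subrK.
  case: k => [|k] in fP IHf shP *.
    apply: PolyLtE (PolyLt0 _) _ => x.
    by rewrite (poly_lt_zero _ fP) (poly_lt_zero _ fP) !mulr0 subrr.
  apply: PolyLtE (PolyLtD (PolyLtX e IHf) (poly_ltZ (y e 0) shP)) _ => x.
  by rewrite !mxE; ring.
- by move=> k f g _ IHf fg; apply: PolyLtE IHf _ => x; rewrite !fg.
Qed.

Lemma poly_lt_shift k f y : poly_lt k f -> poly_lt k (fun x => f (x + y)).
Proof.
move=> fP; apply: PolyLtE
  (PolyLtD (poly_lt_leq (leq_pred k) (poly_lt_diff y fP)) fP) _ => x.
by rewrite subrK.
Qed.

(** Each factor s or s^2 taken from the curve replaces a coordinate of x, so reaching s^j costs at
    least [uphalf j] degrees in x. *)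
Lemma poly_lt_curve k f b c : poly_lt k f ->
  exists Q : 'cV[C]_N -> {poly C},
    (forall x s, (Q x).[s] = f (x + s *: b + s ^+ 2 *: c)) /\
    (forall j, poly_lt (k - uphalf j) (fun x => (Q x)`_j)).
Proof.
move=> fP; elim: fP => {f k}.
- move=> k; exists (fun=> 0); split=> [x s|j]; first by rewrite horner0.
  by apply: PolyLtE (PolyLt0 _) _ => x; rewrite coef0.
- move=> k a; exists (fun=> a%:P); split=> [x s|[|j]]; first by rewrite hornerC.
    exact: PolyLtC.
  by apply: PolyLtE (PolyLt0 _) _ => x; rewrite coefC.
- move=> k f g _ [Q1 [E1 P1]] _ [Q2 [E2 P2]]; exists (fun x => Q1 x + Q2 x).
  split=> [x s|j]; first by rewrite hornerD E1 E2.
  by apply: PolyLtE (PolyLtD (P1 j) (P2 j)) _ => x; rewrite coefD.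
- move=> k e f _ [Q [E P]].
  exists (fun x => (x e 0) *: Q x + (b e 0) *: ('X * Q x)
                   + (c e 0) *: ('X * ('X * Q x))).
  split=> [x s|j]; first by rewrite !(hornerD, hornerZ, hornerM, hornerX) E !mxE; ring.
  apply: PolyLtE (_ : poly_lt _ (fun x => x e 0 * (Q x)`_j
     + b e 0 * (if j is i.+1 then (Q x)`_i else 0)
     + c e 0 * (if j is i.+2 then (Q x)`_i else 0))) _; last first.
    by move=> x; rewrite !coefD !coefZ !coefXM; case: j => [|[|j]].
  have c1 : poly_lt (k.+1 - uphalf j) (fun x => x e 0 * (Q x)`_j).
    have [jk|kj] := leqP (uphalf j) k.
      by rewrite subSn //; apply: PolyLtX.
    apply: PolyLtE (PolyLt0 _) _ => x; rewrite (@poly_lt_zero (fun x => (Q x)`_j)) ?mulr0 //.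
    by apply: poly_lt_leq (P j); lia.
  apply: PolyLtD; first apply: PolyLtD => //; apply: poly_ltZ.
    case: j {c1} => [|j]; first exact: PolyLt0.
    by apply: poly_lt_leq (P j); have := uphalf_half j; rewrite -?uphalfE /=; lia.
  case: j {c1} => [|[|j]]; try exact: PolyLt0.
  by apply: poly_lt_leq (P j); rewrite /=; lia.
- move=> k f g _ [Q [E P]] fg; exists Q; split=> // x s.
  by rewrite E fg.
Qed.

Lemma poly_lt_horner k f (g : 'I_N -> {poly C}) : poly_lt k f ->
  exists P, forall s, P.[s] = f (\col_e (g e).[s]).
Proof.
move=> fP; elim: fP => {f k}.
- by move=> k; exists 0 => s; rewrite horner0.
- by move=> k a; exists a%:P => s; rewrite hornerC.
- move=> k f h _ [P PE] _ [Q QE]; exists (P + Q) => s.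
  by rewrite hornerD PE QE.
- move=> k e f _ [P PE]; exists (g e * P) => s.
  by rewrite hornerM PE mxE.
- by move=> k f h _ [P PE] fh; exists P => s; rewrite PE fh.
Qed.

Lemma nonroot P : P != 0 -> exists s, P.[s] != 0.
Proof.
(* The first [size P] natural numbers are distinct in characteristic 0 and too many to be all
   roots. *)
move=> nzP; pose rs : seq C := [seq i%:R | i <- iota 0 (size P)].
have [/hasP[s _ Ps]|] := boolP (has (fun s => P.[s] != 0) rs); first by exists s.
rewrite -all_predC => /allP Prs.
have := max_poly_roots nzP (rs := rs); rewrite size_map size_iota ltnn => h.
suff: false by []; apply: h.
  by apply/allP => s /Prs /=; rewrite negbK.
by rewrite map_inj_uniq ?iota_uniq //; apply: mulrIn; rewrite oner_eq0.
Qed.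

Lemma horner_eq0 P : (forall s, P.[s] = 0) -> P = 0.
Proof.
move=> P0; apply/eqP; apply: contraT => /nonroot[s].
by rewrite P0 eqxx.
Qed.

End PolynomialFunctions.

(** * Decomposition by the characters of the coordinate sign changes *)

Section EvenDecomposition.
Variables (C : numClosedFieldType) (N : nat).
Implicit Types (f g : 'cV[C]_N -> C) (x : 'cV[C]_N) (S T : {set 'I_N}) (e : 'I_N).

Definition monomial T x : C := \prod_(e in T) x e 0.

Definition flip S x : 'cV[C]_N := \col_e (if e \in S then - x e 0 else x e 0).

Definition toggle e T : {set 'I_N} := if e \in T then T :\ e else e |: T.

Lemma in_toggle e T e' : (e' \in toggle e T) = (e' \in T) (+) (e' == e).
Proof.
rewrite /toggle; case: ifP => eT; rewrite !inE; case: eqP => [->|] //=;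
  by rewrite ?eT ?addbF.
Qed.

Lemma toggleK e : involutive (toggle e).
Proof. by move=> T; apply/setP => e'; rewrite !in_toggle -addbA addbb addbF. Qed.

(** With deg f <= k - 1, the component of T has degree at most (k - 1 - |T|)/2, rounded down; adding
    1 for the strict bound gives the half stated here. It is 0 when |T| >= k, and the component is
    then identically zero. *)
Lemma even_decomposition k f : poly_lt k f ->
  exists g : {set 'I_N} -> 'cV[C]_N -> C,
    (forall T, poly_lt (k.+1 - #|T|)./2 (g T)) /\
    (forall x, f x = \sum_T monomial T x * g T (sqmap x)).
Proof.
move=> fP; elim: fP => {f k}.
- move=> k; exists (fun=> fun=> 0); split=> [T|x]; first exact: PolyLt0.
  by rewrite big1 // => T _; rewrite mulr0.
- move=> k c; exists (fun T => fun=> if T == set0 then c else 0); split=> [T|x].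
    by case: eqP => [->|_]; [rewrite cards0; apply: PolyLtC|apply: PolyLt0].
  rewrite (bigD1 set0) //= eqxx /monomial big_set0 mul1r big1 ?addr0 // => T.
  by move=> /negbTE->; rewrite mulr0.
- move=> k f f' _ [g [gP gE]] _ [g' [gP' gE']].
  exists (fun T x => g T x + g' T x); split=> [T|x]; first exact: PolyLtD.
  rewrite gE gE' -big_split /=; apply: eq_bigr => T _; by rewrite mulrDr.
- move=> k e f _ [g [gP gE]].
  (* Multiplication by coordinate e toggles e in T. If e was already present, a square appears,
     which is a coordinate of [sqmap x]; hence the factor in front of [g (e |: T)]. *)
  exists (fun T x => if e \in T then g (T :\ e) x else x e 0 * g (e |: T) x).
  split=> [T|x].
    have [eT|/negbTE eT] := boolP (e \in T).
      apply: poly_lt_leq (gP _); apply: half_leq.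
      by rewrite [#|T|](cardsD1 e) eT add1n subSS.
    have [Tk|kT] := leqP #|T| k.
      apply: poly_lt_leq (PolyLtX e (gP _)).
      rewrite cardsU1 eT /=; move: #|T| Tk => t tk.
      have -> : (k.+2 - t = (k.+1 - (1 + t)).+2)%N by lia.
      by [].
    apply: PolyLtE (@PolyLt0 _ _ _) _ => x.
    have /poly_lt_zero-> : poly_lt 0 (g (e |: T)); last by rewrite mulr0.
    apply: poly_lt_leq (gP _); rewrite cardsU1 eT /=.
    by have -> : (k.+1 - (1 + #|T|) = 0)%N by lia.
  rewrite gE mulr_sumr (reindex_inj (inv_inj (toggleK e))) /=.
  apply: eq_bigr => T _; rewrite /toggle /monomial; case: ifP => eT.
    by rewrite mulrA [in RHS](big_setD1 e).
  rewrite big_setU1 ?eT //= mxE; ring.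
- move=> k f f' _ [g [gP gE]] ff'; exists g; split=> // x.
  by rewrite -ff' gE.
Qed.

(** This is (-1) to the number of common elements of S and T: the character indexed by T, evaluated
    at the sign change indexed by S. *)
Definition parity S T : C := \prod_(e in T) (if e \in S then -1 else 1).

Lemma monomial_flip S T x : monomial T (flip S x) = parity S T * monomial T x.
Proof.
rewrite -big_split; apply: eq_bigr => e _ /=; rewrite mxE.
by case: ifP; rewrite ?mulN1r ?mul1r.
Qed.

Lemma parity_toggle e S T :
  parity (toggle e S) T = (if e \in T then -1 else 1) * parity S T.
Proof.
rewrite /parity; case: ifP => eT.
  rewrite (big_setD1 e) // [in RHS](big_setD1 e) //= mulrA; congr (_ * _).
    by rewrite in_toggle eqxx; case: (e \in S); rewrite ?mulN1r ?opprK.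
  apply: eq_bigr => e' /setD1P[ne _].
  by rewrite in_toggle (negbTE ne) addbF.
rewrite mul1r; apply: eq_bigr => e' e'T.
rewrite in_toggle; case: eqP => [e'e|]; rewrite ?addbF //.
by rewrite -e'e e'T in eT.
Qed.

Lemma parity_sqr S T : parity S T * parity S T = 1.
Proof.
rewrite -big_split big1 // => e _ /=; case: ifP; by rewrite ?mulN1r ?opprK ?mulr1.
Qed.

Lemma sqmap_flip S x : sqmap (flip S x) = sqmap x.
Proof. by apply/matrixP => e j; rewrite !mxE ord1; case: ifP; rewrite ?sqrrN. Qed.

(** Toggling in S an element that lies in exactly one of T and T' reverses the sign of the summand,
    so the sum equals its negative. *)
Lemma parity_orthogonal T T' : T != T' -> \sum_S parity S T * parity S T' = 0.
Proof.
move=> TT'.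
have [e eTT'] : exists e, (e \in T) (+) (e \in T').
  apply/existsP; apply: contraR TT'; rewrite negb_exists => /forallP h.
  by apply/eqP/setP => e; apply/eqP; have := h e; case: (e \in T); case: (e \in T').
set s := \sum_S _.
have: s = - s.
  rewrite {1}/s (reindex_inj (inv_inj (toggleK e))) -sumrN; apply: eq_bigr => S _.
  rewrite !parity_toggle; move: eTT'.
  by case: (e \in T); case: (e \in T') => //= _; ring.
move/eqP; rewrite -addr_eq0 -mulr2n mulrn_eq0 /=; exact: eqP.
Qed.

(** Summing f over all sign changes against the character of T isolates the component of T, by
    orthogonality. *)
Lemma even_part_vanish f (g : {set 'I_N} -> 'cV[C]_N -> C) x :
    (forall y, f y = \sum_T monomial T y * g T (sqmap y)) ->
    (forall S, f (flip S x) = 0) ->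
  forall T, monomial T x * g T (sqmap x) = 0.
Proof.
move=> fE f0 T.
have: \sum_S parity S T * f (flip S x) = 0.
  by rewrite big1 // => S _; rewrite f0 mulr0.
under eq_bigr => S _ do rewrite fE mulr_sumr.
rewrite exchange_big (bigD1 T) //= [X in _ + X]big1 ?addr0 => [|T' T'T].
  under eq_bigr => S _ do rewrite sqmap_flip monomial_flip -!mulrA mulrA parity_sqr mul1r.
  rewrite sumr_const -mulr_natr => /eqP; rewrite mulf_eq0 => /orP[/eqP//|].
  rewrite pnatr_eq0 => /eqP/card0_eq/(_ set0).
  by rewrite inE.
under eq_bigr => S _ do rewrite sqmap_flip monomial_flip -!mulrA mulrA.
by rewrite -mulr_suml parity_orthogonal ?mul0r // eq_sym.
Qed.

End EvenDecomposition.

(** * Symmetric access to edge coordinates *)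

Section EdgeCoordinates.
Variables (C : numClosedFieldType) (n : nat).
Implicit Types (x y : 'cV[C]_(nedges n)) (i j u v : 'I_n) (k : 'I_(nedges n)).

(* The coordinate of the edge {i, j}; it is 0 when i = j. *)
Definition coord x i j : C :=
  \sum_(k | edge_set (edge_of k) == [set i; j]) x k 0.

Definition edge_vector (F : 'I_n -> 'I_n -> C) : 'cV[C]_(nedges n) :=
  \col_k F (val (edge_of k)).1 (val (edge_of k)).2.

Lemma pair_set_eq i j u v :
  ([set i; j] == [set u; v]) = ((i == u) && (j == v)) || ((i == v) && (j == u)).
Proof.
apply/eqP/idP => [E|/orP[]/andP[/eqP-> /eqP->] //]; last exact: setUC.
have: i \in [set u; v] by rewrite -E !inE eqxx.
have: j \in [set u; v] by rewrite -E !inE eqxx orbT.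
have: u \in [set i; j] by rewrite E !inE eqxx.
have: v \in [set i; j] by rewrite E !inE eqxx orbT.
rewrite !inE.
by do 4![case/orP=> /eqP ?]; subst; rewrite ?eqxx ?orbT.
Qed.

Lemma edge_set_inj : injective (fun k => edge_set (edge_of k)).
Proof.
move=> k l /= /eqP; rewrite /edge_set pair_set_eq => E.
have kE := valP (edge_of k); have lE := valP (edge_of l); rewrite /= in kE lE.
apply: enum_val_inj; apply: val_inj; rewrite -!/(edge_of _) /=.
case/orP: E => /andP[/eqP E1 /eqP E2]; last first.
  by move: kE; rewrite E1 E2 ltnNge ltnW.
by rewrite [LHS]surjective_pairing [RHS]surjective_pairing E1 E2.
Qed.

Lemma edge_indexP i j : i != j -> exists k, edge_set (edge_of k) = [set i; j].
Proof.
wlog ij : i j / (i < j)%N => [h ne|_].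
  have [/h/(_ ne)//|ji|/val_inj/eqP] := ltngtP i j; last by rewrite (negbTE ne).
  by have [|k kE] := h _ _ ji; [rewrite eq_sym|exists k; rewrite setUC].
pose e : edge n := exist _ (i, j) ij.
by exists (enum_rank e); rewrite /edge_of enum_rankK.
Qed.

Lemma edge_ends k : exists i j, i != j /\ edge_set (edge_of k) = [set i; j].
Proof.
exists (val (edge_of k)).1, (val (edge_of k)).2; split=> //.
by have := valP (edge_of k); rewrite /= ltn_neqAle => /andP[].
Qed.

Lemma coord_edge x i j k : edge_set (edge_of k) = [set i; j] -> coord x i j = x k 0.
Proof.
move=> kE; rewrite /coord (bigD1 k) ?kE //= big1 ?addr0 // => l /andP[/eqP lE].
by case/eqP; apply: edge_set_inj; rewrite lE.
Qed.

Lemma coordxx x i : coord x i i = 0.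
Proof.
rewrite /coord big1 // => k /eqP kE; have [u [v [uv E]]] := edge_ends k.
move: kE; rewrite E => /eqP; rewrite pair_set_eq orbb => /andP[/eqP iu /eqP iv].
by rewrite iu iv eqxx in uv.
Qed.

Lemma coordC x i j : coord x i j = coord x j i.
Proof. by rewrite /coord setUC. Qed.

Lemma coord_inj x y : (forall i j, i != j -> coord x i j = coord y i j) -> x = y.
Proof.
move=> xy; apply/colP => k; have [i [j [ij kE]]] := edge_ends k.
by rewrite -!(coord_edge _ kE) xy.
Qed.

Lemma coord_vector F i j : (forall u v, F u v = F v u) -> i != j ->
  coord (edge_vector F) i j = F i j.
Proof.
move=> Fsym /edge_indexP[k kE]; rewrite (coord_edge _ kE) mxE.
move/eqP: kE; rewrite /edge_set pair_set_eq => /orP[]/andP[/eqP-> /eqP->] //.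
Qed.

Lemma coordD x y i j : coord (x + y) i j = coord x i j + coord y i j.
Proof. by rewrite /coord -big_split; apply: eq_bigr => k _; rewrite mxE. Qed.

Lemma coordZ c x i j : coord (c *: x) i j = c * coord x i j.
Proof. by rewrite /coord mulr_sumr; apply: eq_bigr => k _; rewrite mxE. Qed.

Lemma coordN x i j : coord (- x) i j = - coord x i j.
Proof. by rewrite -scaleN1r coordZ mulN1r. Qed.

Lemma coord0 i j : coord 0 i j = 0.
Proof. by rewrite -(scale0r 0) coordZ mul0r. Qed.

Lemma coord_sqmap x i j : coord (sqmap x) i j = coord x i j ^+ 2.
Proof.
have [<-|/edge_indexP[k kE]] := eqVneq i j; first by rewrite !coordxx expr0n.
by rewrite !(coord_edge _ kE) mxE.
Qed.

Lemma coord_meas d (p : 'M[C]_(n, d)) i j :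
  coord (meas p) i j = \sum_(l < d) (p i l - p j l) ^+ 2.
Proof.
have [<-|ij] := eqVneq i j.
  by rewrite coordxx big1 // => l _; rewrite subrr expr0n.
rewrite -[meas p]/(edge_vector (fun i j => \sum_(l < d) (p i l - p j l) ^+ 2)).
by rewrite coord_vector // => u v; apply: eq_bigr => l _; rewrite -sqrrN opprB.
Qed.

Definition coordE := (coordD, coordZ, coordN, coord0, coord_sqmap, coord_meas).

End EdgeCoordinates.

(** * The squared measurement variety: sums, low-degree equations, irreducibility *)

Section MeasurementVariety.
Variables (C : numClosedFieldType) (n : nat).
Implicit Types (x y : 'cV[C]_(nedges n)).

Lemma sqmap_surj N (x : 'cV[C]_N) : exists y : 'cV[C]_N, sqmap y = x.
Proof.
by exists (map_mx sqrtC x); apply/matrixP => i j; rewrite !mxE sqrtCK.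
Qed.

Lemma Mvar0 d : Mvar d n (0 : 'cV[C]_(nedges n)).
Proof.
exists 0; apply: coord_inj => i j _; rewrite !coordE big1 // => l _.
by rewrite !mxE subrr expr0n.
Qed.

Lemma MvarD d r x y : Mvar d n x -> Mvar r n y -> Mvar (d + r) n (x + y).
Proof.
case=> p -> [q ->]; exists (row_mx p q); apply: coord_inj => i j _.
rewrite !coordE big_split_ord /=; congr (_ + _); apply: eq_bigr => l _;
  by rewrite ?row_mxEl ?row_mxEr.
Qed.

Lemma MvarZ d c x : Mvar d n x -> Mvar d n (c *: x).
Proof.
case=> p ->; exists (sqrtC c *: p); apply: coord_inj => i j _.
rewrite !coordE mulr_sumr; apply: eq_bigr => l _.
by rewrite !mxE -mulrBr exprMn sqrtCK.
Qed.

Lemma Mvar_leq d r x : (d <= r)%N -> Mvar d n x -> Mvar r n x.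
Proof.
by move=> /subnKC <- xM; rewrite -[x]addr0; apply: MvarD xM (Mvar0 _).
Qed.

Lemma Mvar1 x (q : 'I_n -> C) :
  (forall i j, i != j -> coord x i j = (q i - q j) ^+ 2) -> Mvar 1 n x.
Proof.
move=> xE; exists (\matrix_(i, l) q i); apply: coord_inj => i j ij.
by rewrite xE // !coordE big_ord_recl big_ord0 addr0 !mxE.
Qed.

(* A cut vector is the measurement of a 1-dimensional 0/1 configuration, and
   2 e_ij is the cut of {i} plus the cut of {j} minus the cut of {i, j}. *)
Lemma Mvar1_generates (g : 'cV[C]_(nedges n) -> C) :
  (forall x y, Mvar 1 n y -> g (x + y) = g x) -> forall x, g x = g 0.
Proof.
move=> gM.
have gE i j c x : i != j ->
    g (x + edge_vector (fun u v => c * ([set u; v] == [set i; j])%:R)) = g x.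
  move=> ij.
  pose cut (S : pred 'I_n) : 'cV[C]_(nedges n) :=
    edge_vector (fun u v => (S u (+) S v)%:R).
  have cutE S u v : u != v -> coord (cut S) u v = (S u (+) S v)%:R.
    by move=> uv; rewrite coord_vector // => s t; rewrite addbC.
  have cutM S : Mvar 1 n (cut S).
    apply: (@Mvar1 _ (fun u => (S u)%:R)) => u v uv.
    by rewrite cutE //; case: (S u); case: (S v) => /=; rewrite ?subrr ?subr0 ?sub0r ?sqrrN ?expr1n ?expr0n.
  have -> : edge_vector (fun u v => c * ([set u; v] == [set i; j])%:R) =
     (c / 2) *: cut (pred1 i) + (c / 2) *: cut (pred1 j)
       + (- (c / 2)) *: cut (pred2 i j).
    apply: coord_inj => u v uv; rewrite !coordD !coordZ !cutE //=.
    rewrite coord_vector //= => [|s t]; last by rewrite setUC.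
    rewrite pair_set_eq; have [ui|ui] := eqVneq u i; have [uj|uj] := eqVneq u j;
    have [vi|vi] := eqVneq v i; have [vj|vj] := eqVneq v j; subst => //=;
    rewrite ?eqxx // in ij uv *; by field.
  by rewrite !addrA !gM //; apply: MvarZ; apply: cutM.
move=> x.
suff gS (s : seq 'I_(nedges n)) : g (\col_k (if k \in s then x k 0 else 0)) = g 0.
  rewrite -(gS (enum 'I_(nedges n))); congr g; apply/colP => k.
  by rewrite mxE mem_enum.
elim: s => [|k s IH].
  by congr g; apply/colP => k; rewrite !mxE.
have [ks|ks] := boolP (k \in s).
  by rewrite -IH; congr g; apply/colP => l; rewrite !mxE inE; case: eqP => // ->; rewrite ks.
have [i [j [ij kE]]] := edge_ends k.
rewrite -IH -[RHS](gE i j (x k 0)) //; congr g; apply/colP => l.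
rewrite !mxE inE -/(edge_set _) -kE (inj_eq (@edge_set_inj _)).
by case: eqP => [->|]; rewrite ?(negbTE ks) ?mulr1 ?mulr0 ?add0r ?addr0.
Qed.

(** Since M_r + M_1 lies in M_{r+1}, the difference of g along a vector of M_1 loses one degree and
    vanishes on M_r, so it is zero by induction. Then g is invariant along M_1, hence constant, and
    g vanishes at 0. *)
Lemma poly_lt_Mvar_eq0 r (g : 'cV[C]_(nedges n) -> C) :
  poly_lt r.+1 g -> (forall x, Mvar r n x -> g x = 0) -> forall x, g x = 0.
Proof.
elim: r g => [|r IH] g gP g0 x.
  have := poly_lt_zero 0 (poly_lt_diff x gP).
  by rewrite add0r (g0 _ (Mvar0 _)) subr0.
rewrite (Mvar1_generates (g := g)) ?g0 //; first exact: Mvar0.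
move=> {x} x y yM; apply/eqP; rewrite -subr_eq0; apply/eqP.
apply: (IH (fun x => g (x + y) - g x)); first exact: poly_lt_diff gP.
move=> z zM; rewrite !g0 ?subrr //; first exact: Mvar_leq zM.
by rewrite -addn1; apply: MvarD.
Qed.

(** Irreducibility of M_{d,n}. On the line of configurations from p to q, both functions become
    polynomials G and H in one variable with H G = 0. As H is nonzero at the end q, G = 0, and g
    vanishes at the end p. *)
Lemma Mvar_factor d (g h : 'cV[C]_(nedges n) -> C) k l :
    poly_lt k g -> poly_lt l h ->
    (exists q : 'M[C]_(n, d), h (meas q) != 0) ->
    (forall x, Mvar d n x -> h x * g x = 0) ->
  forall x, Mvar d n x -> g x = 0.
Proof.
move=> gP hP [q hq] hg _ [p ->].
pose c e : {poly C} := \sum_(l < d)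
  ((p (val (edge_of e)).1 l - p (val (edge_of e)).2 l)%:P * (1 - 'X) +
   (q (val (edge_of e)).1 l - q (val (edge_of e)).2 l)%:P * 'X) ^+ 2.
have cE s : \col_e (c e).[s] = meas (n := n) (d := d) ((1 - s) *: p + s *: q).
  apply/colP => e; rewrite !mxE /c horner_sum; apply: eq_bigr => i _.
  by rewrite horner_exp !(hornerD, hornerM, hornerC, hornerN, hornerX) !mxE; ring.
have [G GE] := poly_lt_horner c gP; have [H HE] := poly_lt_horner c hP.
have /eqP : H * G = 0.
  apply: horner_eq0 => s; rewrite hornerM GE HE cE hg //.
  by eexists.
rewrite mulf_eq0 => /orP[/eqP H0|/eqP G0].
  by move: hq; have := HE 1; rewrite H0 horner0 cE subrr scale0r add0r scale1r => <-; rewrite eqxx.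
by have := GE 0; rewrite G0 horner0 cE subr0 scale0r scale1r addr0.
Qed.

End MeasurementVariety.

(** * Evenness, and quadratic behaviour along signed stars *)

Section UnsquaredVariety.
Variables (C : numClosedFieldType) (n d : nat).
Hypothesis d_gt0 : (0 < d)%N.
Implicit Types (x y z : 'cV[C]_(nedges n)) (i j u v : 'I_n).

Lemma Lvar_flip x S : Lvar d n x -> Lvar d n (flip S x).
Proof. by rewrite /Lvar sqmap_flip. Qed.

Lemma Lvar_even (h : 'cV[C]_(nedges n) -> C) :
    poly_lt (2 * d + 3) h -> (forall x, Lvar d n x -> h x = 0) ->
  exists g, [/\ poly_lt d.+2 g, (forall x, Mvar d n x -> g x = 0) &
                forall x, h x = g (sqmap x)].
Proof.
move=> hP h0; have [g [gP gE]] := even_decomposition hP.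
have g0 T x : Mvar d n x -> g T x = 0.
  apply: (@Mvar_factor _ _ _ _ (monomial T) _ (size (enum T) * 1).+1 (gP T)).
  - apply: PolyLtE (poly_lt_prod (enum T) (fun e => poly_lt_coord C e)) _ => z.
    by rewrite big_enum.
  (* With point i at (i, ..., i), the squared distance of i and j is d (i - j)^2, which is nonzero
     because d > 0. *)
  - exists (\matrix_(i, l) i%:R); apply/prodf_neq0 => e _; rewrite !mxE.
    under eq_bigr => l _ do rewrite !mxE.
    rewrite sumr_const card_ord mulrn_eq0 negb_or -lt0n d_gt0 expf_neq0 //.
    rewrite subr_eq0 eqr_nat; have := valP (edge_of e).
    by rewrite /= ltn_neqAle => /andP[].
  move=> z zM; have [y yE] := sqmap_surj z.
  have := @even_part_vanish _ _ h g y gE _ T; rewrite yE => yT.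
  (* The vanishing product contains the monomial in y. One more factor of that monomial turns it
     into a function of the squares z, to which irreducibility applies. *)
  have zy : monomial T z = monomial T y * monomial T y.
    by rewrite -yE -big_split; apply: eq_bigr => e _; rewrite !mxE expr2.
  rewrite zy -mulrA yT ?mulr0 // => S.
  by apply: h0; apply: Lvar_flip; rewrite /Lvar yE.
(* For T nonempty the bound (2d + 4 - |T|)/2, rounded down, is at most d + 1: degree at most d, just
   within reach of [poly_lt_Mvar_eq0]. *)
have gT T x : T != set0 -> g T x = 0.
  rewrite -card_gt0 => T0; apply: (@poly_lt_Mvar_eq0 _ _ d); last exact: g0.
  apply: poly_lt_leq (gP T); move: #|T| T0 => t t0.
  rewrite -ltnS -[X in (_ < X)%N](doubleK d.+2) -ltnS.
  by have := half_leq (_ : (2 * d + 3).+1 - t <= d.+1.*2.+1)%N; rewrite /= uphalf_double; lia.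
exists (g set0); split; [|exact: g0|].
  apply: poly_lt_leq (gP set0); rewrite cards0 subn0.
  by rewrite -[leqRHS](doubleK d.+2); apply: half_leq; lia.
move=> x; rewrite gE (bigD1 set0) //= /monomial big_set0 mul1r big1 ?addr0 //.
by move=> T T0; rewrite gT // mulr0.
Qed.

Definition signed_star i y :=
  forall u v, u != v -> coord y u v ^+ 2 = ((u == i) || (v == i))%:R.

Definition diff3 (f : 'cV[C]_(nedges n) -> C) z x : C :=
  f (x + 3 *: z) - 3 * f (x + 2 *: z) + 3 * f (x + z) - f x.

(* Along a star direction at i the squared measurements move as if the point i
   escaped to infinity along one axis, which only changes a rank one summand. *)
Lemma Lvar_star_diff3 (h : 'cV[C]_(nedges n) -> C) i y x :
    poly_lt (2 * d + 3) h -> (forall z, Lvar d n z -> h z = 0) ->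
  signed_star i y -> diff3 h y x = 0.
Proof.
move=> hP h0 yS; have [g [gP g0 gE]] := Lvar_even hP h0.
pose b : 'cV[C]_(nedges n) := \col_k (2 * x k 0 * y k 0).
pose c := sqmap y.
have xyE s : sqmap (x + s *: y) = sqmap x + s *: b + s ^+ 2 *: c.
  by apply/colP => k; rewrite !mxE; ring.
have bE u v : u != v -> coord b u v = 2 * coord x u v * coord y u v.
  by move=> /(@edge_indexP n)[k kE]; rewrite !(coord_edge _ kE) mxE.
have [Q [QE QP]] := poly_lt_curve b c gP.
(* A configuration on a line, with i at 0 and j at x_ij y_ij + s. Since y_ij^2 = 1, the squared
   length of ij is (x_ij y_ij)^2 + 2 s x_ij y_ij + s^2, whose variable part is that of s b + s^2 c.
   At the other edges y is 0 and s cancels. *)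
pose q s j : C := if j == i then 0 else coord x i j * coord y i j + s.
pose w : 'cV[C]_(nedges n) := edge_vector (fun u v => (q 0 u - q 0 v) ^+ 2).
have wM s : Mvar 1 n (w + s *: b + s ^+ 2 *: c).
  apply: (@Mvar1 _ _ _ (q s)) => u v uv; rewrite !coordE bE //.
  rewrite coord_vector // => [|a e]; last by ring.
  have := yS u v uv; rewrite /q.
  have [ui|ui] := eqVneq u i; have [vi|vi] := eqVneq v i; subst => //=.
  - by rewrite eqxx in uv.
  - by move=> ->; ring.
  - by rewrite (coordC x u) (coordC y u) => ->; ring.
  - by move/eqP; rewrite sqrf_eq0 => /eqP->; ring.
(* For m >= 3 the bound d + 2 - [uphalf m] is at most d, that is degree at most d - 1. After the
   shift by w, the curve is z plus a curve inside M_1, so it stays in M_d for every z in M_{d-1}. *)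
have Q0 (m : nat) z : (2 < m)%N -> (Q z)`_m = 0.
  move=> m2; rewrite -[z](subrK w).
  move: (z - w) => {}z; have d1 : d.-1.+1 = d by rewrite prednK.
  apply: (@poly_lt_Mvar_eq0 _ n d.-1 (fun z => (Q (z + w))`_m)).
    rewrite d1; apply: (@poly_lt_shift _ _ _ (fun z => (Q z)`_m)).
    apply: poly_lt_leq (QP m).
    by case: m m2 => [|[|[|m]]] //= _; lia.
  move=> {}z zM; suff -> : Q (z + w) = 0 by rewrite coef0.
  apply: horner_eq0 => s; rewrite QE -!addrA g0 // -d1 -addn1.
  by apply: MvarD => //; rewrite addrA.
have hE s : h (x + s *: y) = (Q (sqmap x)).[s] by rewrite gE xyE QE.
have qE s : (Q (sqmap x)).[s] = (Q (sqmap x))`_0 + (Q (sqmap x))`_1 * s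
     + (Q (sqmap x))`_2 * s ^+ 2.
  rewrite (@horner_coef_wide _ 3); last by apply/leq_sizeP => j; apply: Q0.
  by rewrite !big_ord_recr big_ord0 /= add0r expr0 expr1 mulr1.
have h1 := hE 1; have h2 := hE 0; rewrite scale1r in h1.
rewrite scale0r addr0 in h2.
by rewrite /diff3 !hE h1 h2 !qE; ring.
Qed.

End UnsquaredVariety.

(** * Comparing a quadratic direction with its sign changes *)

Section Flips.
Variables (C : numClosedFieldType) (n : nat).
Implicit Types (x y z u : 'cV[C]_(nedges n)) (S : {set 'I_(nedges n)}).
Implicit Types (f : 'cV[C]_(nedges n) -> C) (k l : 'I_(nedges n)).

Lemma flipD S x y : flip S (x + y) = flip S x + flip S y.
Proof. by apply/colP => k; rewrite !mxE; case: (k \in S); rewrite ?opprD. Qed.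

Lemma flipZ S c x : flip S (c *: x) = c *: flip S x.
Proof. by apply/colP => k; rewrite !mxE; case: (k \in S); rewrite ?mulrN. Qed.

Lemma flipK S : involutive (@flip C _ S).
Proof. by move=> x; apply/colP => k; rewrite !mxE; case: (k \in S); rewrite ?opprK. Qed.

Definition diff4 f u x : C :=
  f (x + 4 *: u) - 4 * f (x + 3 *: u) + 6 * f (x + 2 *: u) - 4 * f (x + u) + f x.

(* If f has degree <= 2 along z and z', then its fourth difference along z - z'
   is a multiple of its mixed difference of bidegree (2, 2), which is constant
   along z. *)
Lemma diff4_invariant f z z' x :
    (forall x, diff3 f z x = 0) -> (forall x, diff3 f z' x = 0) ->
  diff4 f (z - z') (x + z) = diff4 f (z - z') x.
Proof.
move=> fz fz'.
have rec w (fw : forall x, diff3 f w x = 0) y :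
    f (y + 3 *: w) = 3 * f (y + 2 *: w) - 3 * f (y + w) + f y.
  apply/eqP; rewrite -subr_eq0 -(fw y) /diff3; apply/eqP; ring.
(* The base point x - 4 z' keeps all indices natural: x + a z + i (z - z') is the grid point (a + i,
   4 - i). The two recurrences then express every grid value through indices at most 2. *)
pose p (i j : nat) := f (x - 4 *: z' + i%:R *: z + j%:R *: z').
have p1 i j : p i.+3 j = 3 * p i.+2 j - 3 * p i.+1 j + p i j.
  set y := x - 4 *: z' + i%:R *: z + j%:R *: z'.
  have pE a : p (a + i)%N j = f (y + a%:R *: z).
    by congr f; apply/colP => k; rewrite !mxE natrD; ring.
  by rewrite (pE 3%N) (pE 2%N) (pE 1%N) scale1r rec.
have p2 i j : p i j.+3 = 3 * p i j.+2 - 3 * p i j.+1 + p i j.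
  set y := x - 4 *: z' + i%:R *: z + j%:R *: z'.
  have pE a : p i (a + j)%N = f (y + a%:R *: z').
    by congr f; apply/colP => k; rewrite !mxE natrD; ring.
  by rewrite (pE 3%N) (pE 2%N) (pE 1%N) scale1r rec.
have dE a : diff4 f (z - z') (x + a%:R *: z) = p (4 + a)%N 0%N - 4 * p (3 + a)%N 1%N
    + 6 * p (2 + a)%N 2%N - 4 * p (1 + a)%N 3%N + p a 4%N.
  have pE i j : (i + j = 4)%N ->
      p (i + a)%N j = f (x + a%:R *: z + i%:R *: (z - z')).
    move=> ij; congr f; apply/colP => k; rewrite !mxE natrD.
    have <- : (i + j)%:R = 4 :> C by rewrite ij.
    by rewrite natrD; ring.
  rewrite /diff4 (pE 4%N 0%N) ?(pE 3%N 1%N) ?(pE 2%N 2%N) ?(pE 1%N 3%N) //.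
  by rewrite -[X in p X 4%N]add0n (pE 0%N 4%N) // scale1r scale0r addr0.
have := dE 1%N; rewrite scale1r => ->; have := dE 0%N; rewrite scale0r addr0 => ->.
by rewrite !addn0 !addn1 !p2 !p1; ring.
Qed.

Lemma diff3_flip f S z :
    (forall x, f (flip S x) = f x) -> (forall x, diff3 f z x = 0) ->
  forall x, diff3 f (flip S z) x = 0.
Proof.
move=> fS fz x; rewrite -(fz (flip S x)) /diff3.
by rewrite -[f (x + 3 *: _)]fS -[f (x + 2 *: _)]fS -[f (x + flip _ _)]fS -[f x]fS
  !flipD !flipZ !flipK.
Qed.

(** The step z - [flip [set k] z] lies along coordinate k, so flipping l fixes it. Invariance along
    z therefore gives invariance along [flip [set l] z], hence along their difference, which lies
    along coordinate l. *)
Lemma diff4_flip_invariant f z k l x :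
    k != l -> (forall S x, f (flip S x) = f x) -> (forall x, diff3 f z x = 0) ->
  diff4 f (z - flip [set k] z) (x + (z - flip [set l] z)) =
  diff4 f (z - flip [set k] z) x.
Proof.
move=> kl fS fz; set u := z - _.
have inv y : diff4 f u (y + z) = diff4 f u y.
  by apply: diff4_invariant => //; apply: diff3_flip.
have ul : flip [set l] u = u.
  apply/colP => e; rewrite !mxE !inE; case: (eqVneq e l) => // ->.
  by rewrite [l == k]eq_sym (negbTE kl) subrr oppr0.
clearbody u; have even y : diff4 f u (flip [set l] y) = diff4 f u y.
  rewrite /diff4 -[f (y + 4 *: _)](fS [set l]) -[f (y + 3 *: _)](fS [set l]).
  rewrite -[f (y + 2 *: _)](fS [set l]) -[f (y + u)](fS [set l]) -[f y](fS [set l]).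
  by rewrite !flipD !flipZ ul.
have inv' y : diff4 f u (y + flip [set l] z) = diff4 f u y.
  by rewrite -even flipD flipK inv even.
by rewrite -inv' addrA subrK inv.
Qed.

End Flips.

(** * Gram minors as equations of the unsquared variety *)

Section GramMinors.
Variables (C : numClosedFieldType) (n d : nat).
Implicit Types (x y z : 'cV[C]_(nedges n)) (b i j : 'I_n) (s : seq 'I_n).

(** Polarisation: if the squares of x are the squared distances of a configuration, this is twice
    the inner product of the vectors from b to i and from b to j. Keeping the factor 2 avoids
    division. *)
Definition gram x b i j : C :=
  coord x b i ^+ 2 + coord x b j ^+ 2 - coord x i j ^+ 2.

Definition gram_minor b s x : C :=
  \det (\matrix_(i < d.+1, j < d.+1) gram x b (nth b s i) (nth b s j)).

Lemma gram_minor_flip b s S x : gram_minor b s (flip S x) = gram_minor b s x.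
Proof.
by congr (\det _); apply/matrixP => i j; rewrite !mxE /gram -!coord_sqmap sqmap_flip.
Qed.

Lemma poly_lt_coordn i j : poly_lt 2 (fun x => coord x i j).
Proof.
have [<-|ij] := eqVneq i j.
  by apply: PolyLtE (@PolyLt0 _ _ _) _ => x; rewrite coordxx.
have [k kE] := edge_indexP ij.
by apply: PolyLtE (poly_lt_coord C k) _ => x; rewrite (coord_edge _ kE).
Qed.

Lemma poly_lt_gram_minor b s : poly_lt (2 * d + 3) (gram_minor b s).
Proof.
have -> : (2 * d + 3 = (d.+1 * 2).+1)%N by lia.
apply: poly_lt_det => i j; have sq u v : poly_lt 3 (fun x => coord x u v ^+ 2).
  exact: poly_ltM (poly_lt_coordn u v) (poly_lt_coordn u v).
by apply: poly_ltB => //; apply: PolyLtD.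
Qed.

(** On a configuration the matrix is 2 U U^T, where U has only d columns, so its rank is less than d
    + 1. *)
Lemma gram_minor_Lvar b s x : Lvar d n x -> gram_minor b s x = 0.
Proof.
case=> p xE.
have {}xE i j : coord x i j ^+ 2 = \sum_(l < d) (p i l - p j l) ^+ 2.
  by rewrite -coord_sqmap xE coord_meas.
pose U : 'M[C]_(d.+1, d) := \matrix_(i, l) (p (nth b s i) l - p b l).
have -> : gram_minor b s x = \det (2 *: U *m U^T).
  congr (\det _); apply/matrixP => i j; rewrite !mxE /gram !xE.
  rewrite -big_split -sumrB; apply: eq_bigr => l _; rewrite !mxE /=; ring.
apply/eqP; rewrite -[_ == 0]negbK -unitfE -unitmxE -row_free_unit /row_free.
rewrite neq_ltn (leq_ltn_trans (mxrankM_maxl _ _)) //.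
by rewrite ltnS rank_leq_col.
Qed.

Lemma autom_star_diff3 (A : 'M[C]_(nedges n)) i y b s x :
    (0 < d)%N -> lin_automorphism (Lvar d n) A ->
  signed_star i y -> diff3 (gram_minor b s) (A *m y) x = 0.
Proof.
move=> d0 [Au [AL _]] yS.
have := @Lvar_star_diff3 C n d d0 (fun x => gram_minor b s (A *m x)) i y (invmx A *m x).
rewrite /diff3 !mulmxDr -!scalemxAr mulKVmx //; apply=> //.
  exact: poly_lt_mulmx (poly_lt_gram_minor _ _).
by move=> z /AL/gram_minor_Lvar.
Qed.

End GramMinors.

(** * Evaluation of bordered Gram minors *)

Section TestConfigurations.
Variables (C : numClosedFieldType) (n : nat).
Implicit Types (x y z : 'cV[C]_(nedges n)) (b i j u v : 'I_n) (s : seq 'I_n).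

Lemma det_mx3 (M : 'M[C]_3) : let a := fun i j : nat => M (inord i) (inord j) in
  \det M = a 0%N 0%N * (a 1%N 1%N * a 2%N 2%N - a 1%N 2%N * a 2%N 1%N)
         - a 0%N 1%N * (a 1%N 0%N * a 2%N 2%N - a 1%N 2%N * a 2%N 0%N)
         + a 0%N 2%N * (a 1%N 0%N * a 2%N 1%N - a 1%N 1%N * a 2%N 0%N).
Proof.
move=> a; have aE (i j : 'I_3) : M i j = a i j by rewrite /a !inord_val.
rewrite (expand_det_row _ ord0) !big_ord_recr big_ord0 /= /cofactor.
rewrite !(expand_det_row _ ord0) !big_ord_recr !big_ord0 /= /cofactor !det_mx11.
rewrite !mxE !aE /= /bump /=; ring.
Qed.

(** Schur complement of the block 2 I, which is the [gram] block of orthonormal vertices. *)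
Lemma det_block_sym m k (X : 'M[C]_m) (Y : 'M[C]_(m, k)) :
  \det (block_mx X Y Y^T 2%:M) = \det (X - 2^-1 *: (Y *m Y^T)) * 2 ^+ k.
Proof.
have -> : \det (block_mx X Y Y^T 2%:M) =
    \det (block_mx X Y Y^T 2%:M *m block_mx 1%:M 0 (- (2^-1 *: Y^T)) 1%:M).
  by rewrite det_mulmx det_lblock !det1 !mulr1.
rewrite mulmx_block !mulmx1 !mulmx0 !mulmxN -scalemxAr mul_scalar_mx scalerA.
by rewrite mulfV ?pnatr_eq0 // scale1r subrr !add0r det_ublock det_scalar.
Qed.

Lemma gramC x b i j : gram x b i j = gram x b j i.
Proof. by rewrite /gram [coord x i j]coordC; ring. Qed.

Lemma gramxx x b i : gram x b i i = 2 * coord x b i ^+ 2.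
Proof. by rewrite /gram coordxx; ring. Qed.

(* Bordering by the vertices of s, which are orthonormal relative to b, leaves a
   3 x 3 determinant. *)
Lemma gram_minor_border b i1 i2 i3 s x :
    uniq s ->
    (forall u, u \in s -> coord x b u ^+ 2 = 1) ->
    (forall u v, u \in s -> v \in s -> u != v -> coord x u v ^+ 2 = 2) ->
    (forall u, u \in s -> gram x b i2 u = 0) ->
    (forall u, u \in s -> gram x b i3 u = 0) ->
    coord x b i2 = 0 -> coord x b i3 = 0 ->
  gram_minor (size s).+2 b (i1 :: i2 :: i3 :: s) x =
  (2 * gram x b i1 i2 * gram x b i1 i3 * gram x b i2 i3
   - (gram x b i1 i1 - 2^-1 * \sum_(u <- s) gram x b i1 u ^+ 2)
     * gram x b i2 i3 ^+ 2) * 2 ^+ size s.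
Proof.
move=> us s1 s2 g2 g3 c2 c3; set t := [:: i1; i2; i3].
pose X := \matrix_(i < 3, j < 3) gram x b (nth b t i) (nth b t j).
pose Y := \matrix_(i < 3, j < size s) gram x b (nth b t i) (nth b s j).
have ntl (i : 'I_3) : nth b (t ++ s) (lshift (size s) i) = nth b t i.
  by rewrite nth_cat; have -> : (lshift (size s) i < size t)%N by exact: (valP i).
have ntr (i : 'I_(size s)) : nth b (t ++ s) (rshift 3 i) = nth b s i.
  have -> : nat_of_ord (rshift 3 i) = (3 + i)%N by [].
  by rewrite nth_cat -[size t]/3%N ltnNge leq_addr addKn.
have -> : gram_minor (size s).+2 b (i1 :: i2 :: i3 :: s) x =
    \det (block_mx X Y Y^T 2%:M).
  rewrite /gram_minor -[(size s).+3]/(3 + size s)%N; congr (\det _).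
  apply/matrixP => i j; rewrite -(splitK i) -(splitK j) mxE -[i1 :: i2 :: i3 :: s]/(t ++ s).
  case: (split i) => i'; case: (split j) => j'; rewrite /unsplit;
    rewrite ?(block_mxEul, block_mxEur, block_mxEdl, block_mxEdr) !mxE ?ntl ?ntr //.
    exact: gramC.
  have [<-|ij] := eqVneq i' j'; first by rewrite gramxx s1 ?mem_nth // mulr1.
  by rewrite /gram !s1 ?s2 ?mem_nth ?nth_uniq ?ltn_ord //= mulr0n; ring.
(* The vertices i2 and i3 are orthogonal to s and at distance 0 from b, so the Schur complement
   corrects only the entry of i1. What remains is symmetric with diagonal (a, 0, 0), whose
   determinant is 2 p q r - a r^2. *)
rewrite det_block_sym det_mx3; congr (_ * _).
have YE (i j : nat) : (i < 3)%N -> (j < 3)%N ->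
    (X - 2^-1 *: (Y *m Y^T)) (inord i) (inord j) =
    gram x b (nth b t i) (nth b t j)
    - 2^-1 * \sum_(u <- s) gram x b (nth b t i) u * gram x b (nth b t j) u.
  move=> i3' j3'; rewrite !mxE !inordK // (big_nth b) big_mkord.
  by congr (_ - _ * _); apply: eq_bigr => l _; rewrite !mxE !inordK.
have z2 (F : 'I_n -> C) : \sum_(u <- s) gram x b i2 u * F u = 0.
  by rewrite big_seq big1 // => u us'; rewrite g2 // mul0r.
have z3 (F : 'I_n -> C) : \sum_(u <- s) gram x b i3 u * F u = 0.
  by rewrite big_seq big1 // => u us'; rewrite g3 // mul0r.
have z2' (F : 'I_n -> C) : \sum_(u <- s) F u * gram x b i2 u = 0.
  by rewrite big_seq big1 // => u us'; rewrite g2 // mulr0.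
have z3' (F : 'I_n -> C) : \sum_(u <- s) F u * gram x b i3 u = 0.
  by rewrite big_seq big1 // => u us'; rewrite g3 // mulr0.
rewrite !YE //= !z2 !z3 !z2' !z3' !(gramxx x b i2) !(gramxx x b i3) c2 c3.
rewrite (gramC x b i2 i1) (gramC x b i3 i1) (gramC x b i3 i2).
under eq_bigr => u _ do rewrite -expr2.
by ring.
Qed.

End TestConfigurations.

(** * Directions along which all Gram minors are quadratic *)

Section StarClassification.
Variables (C : numClosedFieldType) (n : nat).
Implicit Types (x y z : 'cV[C]_(nedges n)) (a b i j u v : 'I_n) (s : seq 'I_n).

Lemma extra_vertices (r : seq 'I_n) k : (size r + k <= n)%N ->
  exists s, [/\ uniq s, size s = k & forall u, u \in s -> u \notin r].
Proof.
move=> rk; exists (take k [seq u <- enum 'I_n | u \notin r]); split.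
- by apply: take_uniq; rewrite filter_uniq ?enum_uniq.
- rewrite size_takel // size_filter.
  have := count_predC (mem r) (enum 'I_n); rewrite size_enum_ord.
  have : (count (mem r) (enum 'I_n) <= size r)%N.
    rewrite -size_filter; apply: uniq_leq_size; first by rewrite filter_uniq ?enum_uniq.
    by move=> u; rewrite mem_filter => /andP[].
  set c := count _ _; set c' := count _ _; lia.
- by move=> u /mem_take; rewrite mem_filter => /andP[].
Qed.

Lemma other_vertex (r : seq 'I_n) : (size r < n)%N -> exists w, w \notin r.
Proof.
rewrite -addn1 => /extra_vertices[[|w s] [_ //= _ wE]].
by exists w; rewrite wE ?mem_head.
Qed.

Definition unit_edge i j : 'cV[C]_(nedges n) :=
  edge_vector (fun u v => ([set u; v] == [set i; j])%:R).

Lemma coord_unit i j u v : i != j ->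
  coord (unit_edge i j) u v = ([set u; v] == [set i; j])%:R.
Proof.
move=> ij; have [<-|uv] := eqVneq u v.
  by rewrite coordxx pair_set_eq; case: (eqVneq u i) => [->|_]; rewrite ?(negbTE ij) ?andbF.
by rewrite coord_vector // => a b; rewrite setUC.
Qed.

Lemma sub_flip z i j k : i != j -> edge_set (edge_of k) = [set i; j] ->
  z - flip [set k] z = (2 * coord z i j) *: unit_edge i j.
Proof.
move=> ij kE; apply/colP => l; rewrite (coord_edge _ kE) !mxE inE -/(edge_set _) -kE.
rewrite (inj_eq (@edge_set_inj _)).
by case: eqP => [->|_]; rewrite ?mulr1 ?mulr0 ?subrr //; ring.
Qed.

(* The vertices of s are orthonormal and all others coincide at the origin. *)
Definition orthonormal_vector s : 'cV[C]_(nedges n) :=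
  edge_vector (fun u v => sqrtC ((u \in s)%:R + (v \in s)%:R)).

Lemma coord_orthonormal s u v : u != v ->
  coord (orthonormal_vector s) u v = sqrtC ((u \in s)%:R + (v \in s)%:R).
Proof. by move=> uv; rewrite coord_vector // => a b; rewrite addrC. Qed.

Lemma coord_orthonormal0 s u v : u \notin s -> v \notin s ->
  coord (orthonormal_vector s) u v = 0.
Proof.
move=> /negbTE us /negbTE vs; have [<-|uv] := eqVneq u v; first exact: coordxx.
by rewrite coord_orthonormal // us vs addr0 sqrtC0.
Qed.

Lemma coord_orthonormal1 s u v : u \notin s -> v \in s ->
  coord (orthonormal_vector s) u v = 1.
Proof.
move=> us vs; rewrite coord_orthonormal; last by apply: contraNneq us => ->.
by rewrite (negbTE us) vs add0r sqrtC1.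
Qed.

Lemma coord_orthonormal2 s u v : u \in s -> v \in s -> u != v ->
  coord (orthonormal_vector s) u v ^+ 2 = 2.
Proof. by move=> us vs uv; rewrite coord_orthonormal // us vs sqrtCK. Qed.

Variables (k : nat) (z : 'cV[C]_(nedges n)).
Hypothesis n_ge : (k + 4 <= n)%N.
Hypothesis z_diff3 : forall b s x, diff3 (gram_minor k.+2 b s) z x = 0.

(** By [diff4_flip_invariant], the fourth difference of a minor along the edge a1 a2 is unchanged by
    a step along a3 a4. On the test family [X], its dependence on the length eta of a3 a4
    contradicts this. *)
Lemma support_not_disjoint a1 a2 a3 a4 : uniq [:: a1; a2; a3; a4] ->
  coord z a1 a2 != 0 -> coord z a3 a4 != 0 -> False.
Proof.
move=> ua z12 z34.
have [s [us sk sa]] : exists s, [/\ uniq s, size s = k &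
    forall u, u \in s -> u \notin [:: a1; a2; a3; a4]].
  by apply: extra_vertices; rewrite /=; lia.
have as_ u : u \in [:: a1; a2; a3; a4] -> u \notin s.
  by move=> ua'; apply/negP => /sa; rewrite ua'.
have s1 : a1 \notin s by rewrite as_ // !inE eqxx.
have s2 : a2 \notin s by rewrite as_ // !inE eqxx ?orbT.
have s3 : a3 \notin s by rewrite as_ // !inE eqxx ?orbT.
have s4 : a4 \notin s by rewrite as_ // !inE eqxx ?orbT.
have {}sa u : u \in s -> [/\ (u == a1) = false, (u == a2) = false,
    (u == a3) = false & (u == a4) = false].
  by move=> /sa; rewrite !inE !negb_or => /and4P[*]; split; apply: negbTE.
move: ua; rewrite /= !inE !negb_or !andbT => /and3P[/and3P[n12 n13 n14] /andP[n23 n24] n34].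
pose D := (negbTE n12, negbTE n13, negbTE n14, negbTE n23, negbTE n24, negbTE n34).
have D' : ((a2 == a1) = false) * ((a3 == a1) = false) * ((a4 == a1) = false) *
   ((a3 == a2) = false) * ((a4 == a2) = false) * ((a4 == a3) = false).
  by do !split; rewrite eq_sym D.
pose X (xi eta : C) : 'cV[C]_(nedges n) :=
  orthonormal_vector s + xi *: unit_edge a1 a2 + eta *: unit_edge a3 a4.
pose f : 'cV[C]_(nedges n) -> C := gram_minor k.+2 a1 [:: a2, a3, a4 & s].
have cX xi eta u v : coord (X xi eta) u v = coord (orthonormal_vector s) u v
    + xi * ([set u; v] == [set a1; a2])%:R + eta * ([set u; v] == [set a3; a4])%:R.
  by rewrite !coordE !coord_unit.
have c1 xi eta u : u \in s -> coord (X xi eta) a1 u = 1.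
  move=> us'; have [A1 A2 A3 A4] := sa u us'.
  by rewrite cX coord_orthonormal1 // !pair_set_eq A1 A2 A3 A4 !andbF ?D /= !mulr0 !addr0.
have c2 xi eta u : u \in s -> coord (X xi eta) a2 u = 1.
  move=> us'; have [A1 A2 A3 A4] := sa u us'.
  by rewrite cX coord_orthonormal1 // !pair_set_eq A1 A2 A3 A4 !andbF ?D /= !mulr0 !addr0.
have c3 xi eta u : u \in s -> coord (X xi eta) a3 u = 1.
  move=> us'; have [A1 A2 A3 A4] := sa u us'.
  by rewrite cX coord_orthonormal1 // !pair_set_eq A1 A2 A3 A4 !andbF ?D /= !mulr0 !addr0.
have c4 xi eta u : u \in s -> coord (X xi eta) a4 u = 1.
  move=> us'; have [A1 A2 A3 A4] := sa u us'.
  by rewrite cX coord_orthonormal1 // !pair_set_eq A1 A2 A3 A4 !andbF ?D /= !mulr0 !addr0.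
have m12 xi eta : coord (X xi eta) a1 a2 = xi.
  by rewrite cX coord_orthonormal0 // !pair_set_eq !(eqxx, D, D') /= mulr1 mulr0 add0r addr0.
have m13 xi eta : coord (X xi eta) a1 a3 = 0.
  by rewrite cX coord_orthonormal0 // !pair_set_eq !(eqxx, D, D') /= !mulr0 !addr0.
have m14 xi eta : coord (X xi eta) a1 a4 = 0.
  by rewrite cX coord_orthonormal0 // !pair_set_eq !(eqxx, D, D') /= !mulr0 !addr0.
have m23 xi eta : coord (X xi eta) a2 a3 = 0.
  by rewrite cX coord_orthonormal0 // !pair_set_eq !(eqxx, D, D') /= !mulr0 !addr0.
have m24 xi eta : coord (X xi eta) a2 a4 = 0.
  by rewrite cX coord_orthonormal0 // !pair_set_eq !(eqxx, D, D') /= !mulr0 !addr0.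
have m34 xi eta : coord (X xi eta) a3 a4 = eta.
  by rewrite cX coord_orthonormal0 // !pair_set_eq !(eqxx, D, D') /= mulr0 mulr1 !add0r.
have fE xi eta : f (X xi eta) =
    (- 2 * xi ^+ 4 * eta ^+ 2 - (2 * xi ^+ 2 - 2^-1 * k%:R * xi ^+ 4) * eta ^+ 4) * 2 ^+ k.
  rewrite /f -[in LHS]sk gram_minor_border ?sk //.
  - rewrite big_seq (eq_bigr (fun=> xi ^+ 4)) => [|u us'].
      rewrite -big_seq big_const_seq count_predT sk iter_addr_0 -mulr_natr.
      by rewrite /gram !(coordxx, m12, m13, m14, m23, m24, m34); ring.
    by rewrite /gram m12 c1 ?c2 //; ring.
  - by move=> u us'; rewrite c1 ?expr1n.
  - move=> u v us' vs' uv; have [A1 A2 A3 A4] := sa u us'.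
    by rewrite cX !pair_set_eq A1 A2 A3 A4 /= !mulr0 !addr0 coord_orthonormal2.
  - by move=> u us'; rewrite /gram m13 c1 ?c3 //; ring.
  - by move=> u us'; rewrite /gram m14 c1 ?c4 //; ring.
have [e eE] := edge_indexP n12; have [g gE] := edge_indexP n34.
have eg : e != g.
  by apply/eqP => eg; move/eqP: gE; rewrite -eg eE pair_set_eq !D.
have key eta : diff4 f ((2 * coord z a1 a2) *: unit_edge a1 a2)
      (X 0 eta + (2 * coord z a3 a4) *: unit_edge a3 a4) =
    diff4 f ((2 * coord z a1 a2) *: unit_edge a1 a2) (X 0 eta).
  rewrite -(sub_flip z n12 eE) -(sub_flip z n34 gE).
  apply: diff4_flip_invariant => // [S x|x]; last exact: z_diff3.
  exact: gram_minor_flip.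
set p := 2 * coord z a1 a2 in key; set q := 2 * coord z a3 a4 in key.
have dE eta : diff4 f (p *: unit_edge a1 a2) (X 0 eta) =
    24 * p ^+ 4 * (2^-1 * k%:R * eta ^+ 4 - 2 * eta ^+ 2) * 2 ^+ k.
  have XE c : X 0 eta + c *: (p *: unit_edge a1 a2) = X (c * p) eta.
    by apply/colP => l; rewrite !mxE; ring.
  have := XE 1; rewrite scale1r => X1.
  rewrite /diff4 !XE X1 !fE; ring.
have XE eta : X 0 eta + q *: unit_edge a3 a4 = X 0 (eta + q).
  by apply/colP => l; rewrite !mxE; ring.
have := key q; have := key 0; rewrite !XE !dE add0r => e0 e1.
(* In eta the fourth difference is proportional to (k/2) eta^4 - 2 eta^2. Subtracting 15 = 2^4 - 1
   times the step from 0 to q from the step from q to 2q cancels the quartic term and leaves 24 q^2;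
   another 24 comes from the fourth difference of xi^4. *)
have : 576 * (p ^+ 4 * q ^+ 2 * 2 ^+ k) = 0.
  move: (congr2 (fun c c' : C => c - 15 * c') e1 e0) => /=.
  move/eqP; rewrite -subr_eq0 => /eqP E; rewrite -[RHS]E; ring.
move/eqP; rewrite !mulf_eq0 !expf_eq0 /p /q ?mulf_eq0 (negbTE z12) (negbTE z34).
by rewrite !pnatr_eq0 /= !andbF.
Qed.

(** With the base b off the triangle, the 3 x 3 determinant has zero diagonal and off-diagonal
    entries -t^2 times the squares of z. The minor along z is then a nonzero multiple of t^6, so it
    is not quadratic. *)
Lemma support_not_triangle b a1 a2 a3 : uniq [:: b; a1; a2; a3] ->
    coord z a1 a2 != 0 -> coord z a1 a3 != 0 -> coord z a2 a3 != 0 ->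
    (forall u v, u \notin [:: a1; a2; a3] -> coord z u v = 0) ->
  False.
Proof.
move=> ua z12 z13 z23 z0.
have [s [us sk sa]] : exists s, [/\ uniq s, size s = k &
    forall u, u \in s -> u \notin [:: b; a1; a2; a3]].
  by apply: extra_vertices; rewrite /=; lia.
have as_ u : u \in [:: b; a1; a2; a3] -> u \notin s.
  by move=> ua'; apply/negP => /sa; rewrite ua'.
have s1 : a1 \notin s by rewrite as_ // !inE eqxx ?orbT.
have s2 : a2 \notin s by rewrite as_ // !inE eqxx ?orbT.
have s3 : a3 \notin s by rewrite as_ // !inE eqxx ?orbT.
have sb : b \notin s by rewrite as_ // !inE eqxx ?orbT.
have zs u v : u \in s -> coord z v u = 0.
  by move/sa; rewrite coordC inE negb_or => /andP[_ /z0].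
have zb v : coord z b v = 0 by apply: z0; move: ua => /= /andP[].
pose X (t : C) := orthonormal_vector s + t *: z.
pose f : 'cV[C]_(nedges n) -> C := gram_minor k.+2 b [:: a1, a2, a3 & s].
have cX t u v : coord (X t) u v = coord (orthonormal_vector s) u v + t * coord z u v.
  by rewrite !coordE.
have cs t u v : u \in s -> v \notin s -> coord (X t) v u = 1.
  by move=> us' vs; rewrite cX coord_orthonormal1 // zs // mulr0 addr0.
have c0 t u v : u \notin s -> v \notin s -> coord (X t) u v = t * coord z u v.
  by move=> us' vs; rewrite cX coord_orthonormal0 // add0r.
have gs t u v : coord z b v = 0 -> u \in s -> v \notin s -> gram (X t) b v u = 0.
  by move=> zv us' vs; rewrite /gram (c0 t b) // !cs // zv; ring.
have fE t : f (X t) =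
    - 2 * (coord z a1 a2 * coord z a1 a3 * coord z a2 a3) ^+ 2 * t ^+ 6 * 2 ^+ k.
  rewrite /f -[in LHS]sk gram_minor_border ?sk //.
  - rewrite big_seq big1 => [|u us']; last by rewrite gs // expr0n.
    by rewrite /gram !coordxx !c0 // !zb; ring.
  - by move=> u us'; rewrite cs ?expr1n.
  - move=> u v us' vs' uv.
    by rewrite cX zs // mulr0 addr0 coord_orthonormal2.
  - by move=> u us'; rewrite gs.
  - by move=> u us'; rewrite gs.
  - by rewrite c0 // zb mulr0.
  - by rewrite c0 // zb mulr0.
have := z_diff3 b [:: a1, a2, a3 & s] (X 0); rewrite -/f /diff3.
have XE c : X 0 + c *: z = X c by rewrite /X scale0r addr0.
have := XE 1; rewrite scale1r => ->; rewrite !XE !fE => E.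
(* The third difference of t^6 at 0 is 729 - 192 + 3 = 540, and the minor has coefficient -2. *)
have : 1080 * ((coord z a1 a2 * coord z a1 a3 * coord z a2 a3) ^+ 2 * 2 ^+ k) = 0.
  by rewrite -[RHS]oppr0 -[in RHS]E; ring.
move/eqP; rewrite !mulf_eq0 !expf_eq0 ?mulf_eq0 (negbTE z12) (negbTE z13) (negbTE z23).
by rewrite !pnatr_eq0 /= !andbF.
Qed.

(** The vertices b, v, w are three leaves of the star at j. A length m on the edge vw separates the
    wanted product, which comes with m^2, from the term [J], which comes with m^4 and collects the
    contribution of s. *)
Lemma support_star_sqr b j v w : uniq [:: b; j; v; w] ->
    (forall u u', u != j -> u' != j -> coord z u u' = 0) ->
  (coord z j b ^+ 2 - coord z j v ^+ 2) * (coord z j b ^+ 2 - coord z j w ^+ 2) = 0.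
Proof.
move=> ua z0.
have [s [us sk sa]] : exists s, [/\ uniq s, size s = k &
    forall u, u \in s -> u \notin [:: b; j; v; w]].
  by apply: extra_vertices; rewrite /=; lia.
have as_ u : u \in [:: b; j; v; w] -> u \notin s.
  by move=> ua'; apply/negP => /sa; rewrite ua'.
have sj : j \notin s by rewrite as_ // !inE eqxx ?orbT.
have sv : v \notin s by rewrite as_ // !inE eqxx ?orbT.
have sw : w \notin s by rewrite as_ // !inE eqxx ?orbT.
have sb : b \notin s by rewrite as_ // !inE eqxx ?orbT.
have sE u : u \in s -> [/\ u == v = false, u == w = false & u != j].
  by move=> /sa; rewrite !inE !negb_or => /and4P[_ ? /negbTE-> /negbTE->].
move: ua; rewrite /= !inE !negb_or !andbT => /and3P[/and3P[nbj nbv nbw] /andP[njv njw] nvw].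
have nvj : v != j by rewrite eq_sym.
have nwj : w != j by rewrite eq_sym.
pose X (m t : C) := orthonormal_vector s + m *: unit_edge v w + t *: z.
pose f : 'cV[C]_(nedges n) -> C := gram_minor k.+2 b [:: j, v, w & s].
have cX m t u u' : coord (X m t) u u' = coord (orthonormal_vector s) u u'
    + m * ([set u; u'] == [set v; w])%:R + t * coord z u u'.
  by rewrite !coordE coord_unit.
have cs m t u u' : u \in s -> u' \notin s -> coord (X m t) u' u = 1 + t * coord z u' u.
  move=> us' vs; have [uv uw _] := sE u us'.
  by rewrite cX coord_orthonormal1 // pair_set_eq uv uw !andbF mulr0 addr0.
have zs u u' : u' != j -> u \in s -> coord z u' u = 0.
  by move=> u'j us'; rewrite z0 //; have [] := sE u us'.
have cb m t : coord (X m t) b j = t * coord z j b.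
  by rewrite cX coord_orthonormal0 // pair_set_eq (negbTE nbv) (negbTE nbw) mulr0 !add0r coordC.
have cbv m t : coord (X m t) b v = 0.
  rewrite cX coord_orthonormal0 // pair_set_eq (negbTE nbv) (negbTE nbw) mulr0 !add0r.
  by rewrite z0 ?mulr0.
have cbw m t : coord (X m t) b w = 0.
  rewrite cX coord_orthonormal0 // pair_set_eq (negbTE nbv) (negbTE nbw) mulr0 !add0r.
  by rewrite z0 ?mulr0.
have cjv m t : coord (X m t) j v = t * coord z j v.
  by rewrite cX coord_orthonormal0 // pair_set_eq (negbTE njv) (negbTE njw) mulr0 !add0r.
have cjw m t : coord (X m t) j w = t * coord z j w.
  by rewrite cX coord_orthonormal0 // pair_set_eq (negbTE njv) (negbTE njw) mulr0 !add0r.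
have cvw m t : coord (X m t) v w = m.
  rewrite cX coord_orthonormal0 // pair_set_eq !eqxx add0r mulr1.
  by rewrite z0 ?mulr0 ?addr0.
pose J t := gram (X 0 t) b j j - 2^-1 * \sum_(u <- s) gram (X 0 t) b j u ^+ 2.
set p := coord z j b ^+ 2 - coord z j v ^+ 2.
set r := coord z j b ^+ 2 - coord z j w ^+ 2.
have fE m t : f (X m t) = (- 2 * p * r * t ^+ 4 * m ^+ 2 - J t * m ^+ 4) * 2 ^+ k.
  rewrite /f -[in LHS]sk gram_minor_border ?sk //.
  - have -> : gram (X m t) b j j - 2^-1 * \sum_(u <- s) gram (X m t) b j u ^+ 2 = J t.
      rewrite /J !gramxx !cb; congr (_ - _ * _); rewrite !big_seq.
      by apply: eq_bigr => u us'; rewrite /gram !cb !cs.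
    by rewrite /gram cb cbv cbw cjv cjw cvw /p /r; ring.
  - by move=> u us'; rewrite cs // zs // mulr0 addr0 expr1n.
  - move=> u u' us' vs' uv; have [A1 A2 A3] := sE u us'.
    by rewrite cX pair_set_eq A1 A2 mulr0 addr0 zs // mulr0 addr0 coord_orthonormal2.
  - by move=> u us'; rewrite /gram cbv !cs // !zs //; ring.
  - by move=> u us'; rewrite /gram cbw !cs // !zs //; ring.
have XE m c : X m 0 + c *: z = X m c by rewrite /X scale0r addr0.
have XE1 m : X m 0 + z = X m 1 by rewrite -(XE m 1) scale1r.
(* The values m = 1 and m = ['i] have the same m^4 and opposite m^2, so subtraction eliminates [J].
   The third difference of t^4 at 0 is 81 - 48 + 3 = 36, and 144 is 2 times 2 times 36. *)
have := z_diff3 b [:: j, v, w & s] (X 'i 0); rewrite -/f /diff3.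
have := z_diff3 b [:: j, v, w & s] (X 1 0); rewrite -/f /diff3.
rewrite !XE !XE1 !fE (exprM 'i 2 2) sqrCi => E1 E2.
have : 144 * (p * r * 2 ^+ k) = 0.
  move: (congr2 (fun c c' : C => c' - c) E1 E2); rewrite /= subr0 => E.
  by rewrite -[RHS]E; ring.
move/eqP; rewrite !mulf_eq0 !expf_eq0 !pnatr_eq0 /= !andbF orbF => E.
by apply/eqP; rewrite mulf_eq0.
Qed.

Lemma support_adjacent a b u v : coord z a b != 0 -> coord z u v != 0 ->
  [|| a == u, a == v, b == u | b == v].
Proof.
move=> zab zuv; apply: contraT; rewrite !negb_or => /and4P[au av bu bv].
have ab : a != b by apply: contraNneq zab => ->; rewrite coordxx.
have uv : u != v by apply: contraNneq zuv => ->; rewrite coordxx.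
by case: (support_not_disjoint (a1 := a) (a2 := b) (a3 := u) (a4 := v)) => //=;
  rewrite !inE !negb_or ab au av bu bv uv.
Qed.

(** Pairwise meeting edges form a star or a triangle. A triangle is excluded by
    [support_not_triangle], whose outside vertex exists because n >= 4. *)
Lemma support_center a b : coord z a b != 0 ->
  exists2 j, j \in [:: a; b] & forall u v, u != j -> v != j -> coord z u v = 0.
Proof.
move=> zab; have ab : a != b by apply: contraNneq zab => ->; rewrite coordxx.
pose avoid j := [exists u, [exists v, [&& u != j, v != j & coord z u v != 0]]].
have avoidP j : ~~ avoid j -> forall u v, u != j -> v != j -> coord z u v = 0.
  move=> + u v uj vj; rewrite negb_exists => /forallP/(_ u).
  by rewrite negb_exists => /forallP/(_ v); rewrite uj vj negbK => /eqP.
have avoid_edge a' b' : coord z a' b' != 0 -> avoid a' ->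
    exists2 c, c != a' & coord z b' c != 0.
  move=> z' /existsP[u /existsP[v /and3P[ua va zuv]]].
  have := support_adjacent z' zuv.
  rewrite ![a' == _]eq_sym (negbTE ua) (negbTE va) /= => /orP[]/eqP->.
    by exists v.
  by exists u; rewrite // coordC.
have [|/avoidP ha] := boolP (avoid a); last by exists a; rewrite ?inE ?eqxx.
have [|/avoidP hb] := boolP (avoid b); last by exists b; rewrite ?inE ?eqxx ?orbT.
have zba : coord z b a != 0 by rewrite coordC.
move=> /(avoid_edge _ _ zba)[c cb zac] /(avoid_edge _ _ zab)[c' c'a zbc'].
have ac : a != c by apply: contraNneq zac => ->; rewrite coordxx.
have E : c' = c.
  have := support_adjacent zac zbc'.
  by rewrite (negbTE ab) ![_ == c']eq_sym (negbTE c'a) (negbTE cb) /= => /eqP.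
subst c'.
have [|w wE] := @other_vertex [:: a; b; c]; first by rewrite /=; lia.
exfalso; apply: (@support_not_triangle w a b c) => //.
  by rewrite cons_uniq wE /= !inE !negb_or ab ac eq_sym cb.
move=> u v; rewrite !inE !negb_or => /and3P[ua ub uc]; apply/eqP.
apply: contraT => zuv.
have := support_adjacent zac zuv; have := support_adjacent zbc' zuv.
have := support_adjacent zab zuv.
rewrite ![_ == u]eq_sym (negbTE ua) (negbTE ub) (negbTE uc) /=.
have ba : (b == a) = false by rewrite eq_sym (negbTE ab).
case: (eqVneq a v) => [<-|_ /= /eqP<-]; first by rewrite ba (negbTE c'a).
by rewrite (negbTE cb).
Qed.

Lemma star_classification : z != 0 -> exists j (q : C), q != 0 /\
  forall u v, u != v -> coord z u v ^+ 2 = q * ((u == j) || (v == j))%:R.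
Proof.
move=> nz.
have [a [b zab]] : exists a b, coord z a b != 0.
  have [/existsP[a /existsP[b ?]]|h] :=
    boolP [exists a, [exists b, coord z a b != 0]]; first by exists a, b.
  case/eqP: nz; apply: coord_inj => a b _; rewrite coord0; apply/eqP.
  apply: contraNT h => ?; apply/existsP; exists a; apply/existsP; by exists b.
have [j jab z0] := support_center zab.
have eqsq u v : u != j -> v != j -> coord z j u ^+ 2 = coord z j v ^+ 2.
  move=> uj vj; have [<-//|uv] := eqVneq u v.
  have [|w] := @other_vertex [:: j; u; v]; first by rewrite /=; lia.
  rewrite !inE !negb_or => /and3P[wj wu wv].
  have e1 : (coord z j w ^+ 2 - coord z j u ^+ 2) * (coord z j w ^+ 2 - coord z j v ^+ 2) = 0.
    by apply: support_star_sqr => //=; rewrite !inE !negb_or wj wu wv uv ![j == _]eq_sym uj vj.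
  have e2 : (coord z j u ^+ 2 - coord z j w ^+ 2) * (coord z j u ^+ 2 - coord z j v ^+ 2) = 0.
    apply: support_star_sqr => //=.
    by rewrite !inE !negb_or uj uv [u == w]eq_sym wu ![j == _]eq_sym vj wj wv.
  have e3 : (coord z j v ^+ 2 - coord z j w ^+ 2) * (coord z j v ^+ 2 - coord z j u ^+ 2) = 0.
    apply: support_star_sqr => //=.
    by rewrite !inE !negb_or vj [v == u]eq_sym uv [v == w]eq_sym wv ![j == _]eq_sym uj wj wu.
  (* For the squares U, V, W at the leaves u, v, w, (U - W)(U - V) + (V - W)(V - U) = (U - V)^2. *)
  apply/eqP; rewrite -subr_eq0 -sqrf_eq0; apply/eqP.
  by rewrite -[RHS](addr0 0) -{1}e2 -e3; ring.
exists j, (coord z a b ^+ 2); split; first by rewrite sqrf_eq0.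
have ab : a != b by apply: contraNneq zab => ->; rewrite coordxx.
have [c cj ->] : exists2 c, c != j & coord z a b ^+ 2 = coord z j c ^+ 2.
  move: jab; rewrite !inE => /orP[]/eqP->; first by exists b; rewrite // eq_sym.
  by exists a; rewrite // coordC.
move=> u v uv; have [uj|uj] := eqVneq u j.
  by rewrite mulr1 uj (eqsq v c) // -uj eq_sym.
have [vj|vj] := eqVneq v j; first by rewrite mulr1 vj coordC (eqsq u c).
by rewrite z0 // mulr0 expr0n.
Qed.

End StarClassification.

(** * From maps preserving stars to signed vertex permutations *)

Section MonomialAutomorphisms.
Variables (C : numClosedFieldType) (n : nat).
Hypothesis n_ge3 : (2 < n)%N.
Implicit Types (x y z : 'cV[C]_(nedges n)) (A B : 'M[C]_(nedges n)).
Implicit Types (i j u v w : 'I_n).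

Definition star_support j z := forall u v, u != j -> v != j -> coord z u v = 0.

Lemma lin_automorphism_inv (V : 'cV[C]_(nedges n) -> Prop) A :
  lin_automorphism V A -> lin_automorphism V (invmx A).
Proof.
case=> Au [AV AS]; split; first by rewrite unitmx_inv.
split=> [x /AS[y [Vy <-]]|y Vy]; first by rewrite mulKmx.
by exists (A *m y); split; [apply: AV|rewrite mulKmx].
Qed.

Lemma unit_edge_delta i j k : edge_set (edge_of k) = [set i; j] ->
  unit_edge C i j = delta_mx k 0.
Proof.
move=> kE; apply/colP => l; rewrite !mxE -/(edge_set _) -kE.
by rewrite (inj_eq (@edge_set_inj _)) eqxx andbT.
Qed.

Lemma unit_edgeC i j : unit_edge C i j = unit_edge C j i.
Proof. by apply/colP => k; rewrite !mxE (setUC [set j]). Qed.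

Lemma star_support_mulmx B j j' z :
    (forall v, v != j -> star_support j' (B *m unit_edge C j v)) ->
  star_support j z -> star_support j' (B *m z).
Proof.
move=> BE zj u v uj vj.
have -> : B *m z = \sum_k z k 0 *: (B *m delta_mx k 0).
  rewrite [in LHS](matrix_sum_delta z) mulmx_sumr; apply: eq_bigr => k _.
  by rewrite big_ord_recl big_ord0 addr0 -scalemxAr (ord1 ord0).
elim/big_rec: _ => [|k t _ IH]; first by rewrite coord0.
rewrite coordD coordZ IH addr0; have [a [b [ab kE]]] := edge_ends k.
rewrite -(unit_edge_delta kE) -(coord_edge z kE).
have [aj|aj] := eqVneq a j; first by rewrite aj BE ?mulr0 // -aj eq_sym.
have [bj|bj] := eqVneq b j; first by rewrite bj unit_edgeC BE ?mulr0 // -bj.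
by rewrite zj ?mul0r.
Qed.

Lemma star_support_meet j j' z : j != j' ->
    star_support j z -> star_support j' z ->
  z = coord z j j' *: unit_edge C j j'.
Proof.
move=> jj' zj zj'; apply: coord_inj => u v uv; rewrite coordZ coord_unit //.
rewrite pair_set_eq; have [uj|uj] := eqVneq u j.
  have [vj'|vj'] := eqVneq v j'; first by rewrite uj vj' mulr1.
  by rewrite zj' ?uj ?(negbTE jj') //= mulr0.
have [vj|vj] := eqVneq v j; last by rewrite zj // andbF mulr0.
have [uj'|uj'] := eqVneq u j'; first by rewrite vj uj' mulr1 coordC.
by rewrite zj' ?mulr0 // vj.
Qed.

Lemma coord_unitxx i j : i != j -> coord (unit_edge C i j) i j = 1.
Proof. by move=> ij; rewrite coord_unit // eqxx. Qed.

Lemma mulmx_neq0 A z : A \in unitmx -> z != 0 -> A *m z != 0.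
Proof.
by move=> Au; apply: contraNneq => Az; rewrite -(mulKmx Au z) Az mulmx0.
Qed.

Lemma unit_edge_neq0 i j : i != j -> unit_edge C i j != 0.
Proof.
move=> ij; apply/eqP => E; have := coord_unitxx ij.
by rewrite E coord0 => /eqP; rewrite eq_sym oner_eq0.
Qed.

(** The map tau inverts sigma: otherwise all edge vectors at i would be supported in the star of
    another vertex, which fails for the edge from i to a third vertex. The image of the edge vector
    ij then lies in two star spans, which meet in a line. *)
Lemma vertex_map A :
    A \in unitmx ->
    (forall i, exists j, forall v, v != i -> star_support j (A *m unit_edge C i v)) ->
    (forall i, exists j, forall v, v != i ->
       star_support j (invmx A *m unit_edge C i v)) ->
  exists2 sigma : 'I_n -> 'I_n, injective sigma &
    forall i j, i != j -> exists2 c, c != 0 &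
      A *m unit_edge C i j = c *: unit_edge C (sigma i) (sigma j).
Proof.
move=> Au /fin_all_exists[sigma sE] /fin_all_exists[tau tE].
have st i : tau (sigma i) = i.
  have unitS v : v != i -> star_support (tau (sigma i)) (unit_edge C i v).
    move=> vi; rewrite -(mulKmx Au (unit_edge C i v)).
    by apply: star_support_mulmx (sE i v vi) => w; apply: tE.
  apply/eqP; apply: contraT => ti.
  have [|v] := @other_vertex n [:: i; tau (sigma i)]; first by rewrite /=.
  rewrite !inE negb_or => /andP[vi vt].
  have iv : i != v by rewrite eq_sym.
  have := unitS v vi i v; rewrite coord_unitxx // => /(_ _ _)/eqP.
  by rewrite oner_eq0; apply; rewrite // eq_sym.
have sI : injective sigma by apply: can_inj st.
exists sigma => // i j ij; have sij : sigma i != sigma j by rewrite (inj_eq sI).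
set z := A *m _; have zE : z = coord z (sigma i) (sigma j) *: unit_edge C (sigma i) (sigma j).
  apply: star_support_meet => //; first by apply: sE; rewrite eq_sym.
  by rewrite /z unit_edgeC; apply: sE.
exists (coord z (sigma i) (sigma j)) => //; apply: contraTneq (unit_edge_neq0 ij) => c0.
by rewrite negbK -(mulKmx Au (unit_edge C i j)) -/z zE c0 scale0r mulmx0.
Qed.

Lemma signed_permutation A (sigma : 'I_n -> 'I_n) (c : 'I_n -> 'I_n -> C) :
    injective sigma ->
    (forall i j, i != j -> c i j != 0) ->
    (forall i j, i != j ->
       A *m unit_edge C i j = c i j *: unit_edge C (sigma i) (sigma j)) ->
    (forall i j v, i != j -> i != v -> c i j ^+ 2 = c i v ^+ 2) ->
  exists (a : C) (S : 'M[C]_(nedges n)) (sigma : 'S_n),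
    [/\ a != 0, is_diag_mx S, (forall k, S k k = 1 \/ S k k = -1) &
        A = a *: (S *m edge_perm_mx sigma)].
Proof.
move=> sI c0 AE cE.
have cC i j : i != j -> c i j = c j i.
  move=> ij; have sij : sigma i != sigma j by rewrite (inj_eq sI).
  have := AE i j ij; rewrite unit_edgeC AE 1?eq_sym // unit_edgeC => E.
  have := congr1 (fun z => coord z (sigma i) (sigma j)) E.
  by rewrite /= !coordZ coord_unitxx // !mulr1.
have [|i0 _] := @other_vertex n [::]; first by rewrite /=; lia.
have [|j0] := @other_vertex n [:: i0]; first by rewrite /=; lia.
rewrite inE eq_sym => ij0; set a := c i0 j0.
have ca i j : i != j -> c i j ^+ 2 = a ^+ 2.
  move=> ij; have [i0i|i0i] := eqVneq i0 i; first by rewrite /a -i0i (cE i0 j j0) // i0i.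
  rewrite (cE i j i0) 1?[i == i0]eq_sym // cC 1?[i == i0]eq_sym //; exact: cE.
have colE i j k l : i != j -> edge_set (edge_of l) = [set i; j] ->
    A k l = c i j * (edge_set (edge_of k) == [set sigma i; sigma j])%:R.
  move=> ij lE; have -> : A k l = (A *m unit_edge C i j) k 0.
    by rewrite (unit_edge_delta lE) -colE mxE.
  by rewrite AE // !mxE.
pose s : 'S_n := perm sI.
have imE i j : [set s x | x in [set i; j]] = [set sigma i; sigma j].
  by rewrite imsetU1 imset_set1 !permE.
(* Each row of A has a single nonzero entry, so the row sum reads it off without naming the inverse
   edge permutation; this supplies the diagonal of S. *)
have rowE i j k l : i != j -> edge_set (edge_of l) = [set i; j] ->
    edge_set (edge_of k) = [set sigma i; sigma j] -> \sum_l' A k l' = c i j.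
  move=> ij lE kE; rewrite (bigD1 l) //= (colE i j) // kE eqxx mulr1.
  rewrite big1 ?addr0 // => l' l'l; have [u [v [uv l'E]]] := edge_ends l'.
  rewrite (colE u v) // kE -!imE; case: eqP => [|_]; last by rewrite mulr0.
  move/(imset_inj (@perm_inj _ s)) => E.
  by case/eqP: l'l; apply: edge_set_inj; rewrite /= lE E.
have a0 : a != 0 by apply: c0.
exists a, (diag_mx (\row_k (a^-1 * \sum_l A k l))), s; split=> //.
- move=> k; rewrite !mxE eqxx mulr1n; have [u [v [uv kE]]] := edge_ends k.
  have [i iE] : exists i, sigma i = u by exists ((s^-1)%g u); rewrite -[sigma _]permE permKV.
  have [j jE] : exists j, sigma j = v by exists ((s^-1)%g v); rewrite -[sigma _]permE permKV.
  have ij : i != j by apply: contraNneq uv => ij; rewrite -iE -jE ij.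
  have [l lE] := edge_indexP ij.
  rewrite (rowE i j k l) // ?iE ?jE //.
  have /eqP := ca i j ij; rewrite eqf_sqr => /orP[]/eqP->.
    by left; rewrite mulVf.
  by right; rewrite mulrN mulVf.
- apply/matrixP => k l; rewrite mxE mul_diag_mx !mxE.
  have [i [j [ij lE]]] := edge_ends l; rewrite lE imE (colE i j) //.
  case: eqP => [kE|_]; last by rewrite !mulr0.
  by rewrite (rowE i j k l) // !mulr1 mulrA mulfV ?mul1r.
Qed.

End MonomialAutomorphisms.

(** * The case d >= 2: images of signed stars *)

Section StarAutomorphisms.
Variables (C : numClosedFieldType) (n : nat).
Hypothesis n_ge5 : (4 < n)%N.
Implicit Types (x y z : 'cV[C]_(nedges n)) (A : 'M[C]_(nedges n)).
Implicit Types (i j u v w : 'I_n) (T : {set 'I_n}).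

Definition star_vector i T : 'cV[C]_(nedges n) :=
  edge_vector (fun u v => if u == i then (-1) ^+ (v \in T) else
                          if v == i then (-1) ^+ (u \in T) else 0).

Lemma coord_star i T u v : u != v ->
  coord (star_vector i T) u v = if u == i then (-1) ^+ (v \in T) else
                                if v == i then (-1) ^+ (u \in T) else 0.
Proof.
move=> uv; rewrite coord_vector // => a b.
by case: (eqVneq a i) => [->|_]; case: (eqVneq b i) => [E|_]; rewrite ?E.
Qed.

Lemma signed_star_vector i T : signed_star i (star_vector i T).
Proof.
move=> u v uv; rewrite coord_star //.
case: (eqVneq u i) => [_|_]; first by rewrite sqrr_sign.
by case: (eqVneq v i) => [_|_]; rewrite ?sqrr_sign ?expr0n.
Qed.

Definition star_multiple j z := exists2 q : C, q != 0 &
  forall u v, u != v -> coord z u v ^+ 2 = q * ((u == j) || (v == j))%:R.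

Lemma star_multiple_support j z : star_multiple j z -> star_support j z.
Proof.
case=> q _ zq u v uj vj; have [<-|uv] := eqVneq u v; first exact: coordxx.
have := zq u v uv; rewrite (negbTE uj) (negbTE vj) mulr0 => /eqP.
by rewrite sqrf_eq0 => /eqP.
Qed.

Lemma star_multiple_neq0 j v z : star_multiple j z -> j != v -> coord z j v != 0.
Proof.
by case=> q q0 zq jv; rewrite -sqrf_eq0 zq // eqxx mulr1.
Qed.

Section StarPreserving.
Variable A : 'M[C]_(nedges n).
Hypothesis A_unit : A \in unitmx.
Hypothesis A_star : forall i y, signed_star i y -> exists j, star_multiple j (A *m y).

(** As n >= 5, there is a vertex w other than j, j', j2, j3. At the edge jw, z1 is nonzero and z2 is
    zero, so z3 or z4 must be centred at j. *)
Lemma star_sum (z1 z2 z3 z4 : 'cV[C]_(nedges n)) j j' j2 j3 :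
    z1 + z4 = z2 + z3 -> j != j' ->
    star_multiple j z1 -> star_multiple j' z2 ->
    star_multiple j2 z3 -> star_multiple j3 z4 ->
  (j2 == j) || (j3 == j).
Proof.
move=> zE jj' S1 S2 S3 S4; apply: contraT; rewrite negb_or => /andP[j2j j3j].
have [|w] := @other_vertex n [:: j; j'; j2; j3]; first by [].
rewrite !inE !negb_or => /and4P[wj wj' wj2 wj3].
have jw : j != w by rewrite eq_sym.
have := congr1 (fun z => coord z j w) zE; rewrite /= !coordD.
rewrite eq_sym in j2j; rewrite eq_sym in j3j.
rewrite (star_multiple_support S2) // (star_multiple_support S3) //.
rewrite (star_multiple_support S4) // !addr0 => /eqP.
by rewrite (negbTE (star_multiple_neq0 S1 jw)).
Qed.

(** Write y_T for [star_vector i T]. If the centres differ, then for every further leaf v the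
    relation y_0 + y_{v1 v} = y_{v1} + y_v yields a combination z whose image lies on the line of
    the edge vector jj'. Two such leaves give proportional combinations, which their coordinates
    exclude. *)
Lemma star_center i v1 j j' : v1 != i ->
    star_multiple j (A *m star_vector i set0) ->
    star_multiple j' (A *m star_vector i [set v1]) ->
  j = j'.
Proof.
move=> v1i Sj Sj'; apply/eqP; apply: contraT => jj'.
have sN T : exists j, star_multiple j (A *m star_vector i T).
  exact: A_star (@signed_star_vector i T).
have sumE v : v != i -> v != v1 -> star_vector i set0 + star_vector i [set v1; v] =
    star_vector i [set v1] + star_vector i [set v].
  move=> vi vv1; apply: coord_inj => a b ab; rewrite !coordD !coord_star //.
  rewrite !inE; case: (a == i).
    by case: (eqVneq b v1) => [->|_]; rewrite 1?eq_sym ?(negbTE vv1) /= ?expr0 ?orbF;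
       case: (b == v); rewrite // addrC.
  case: (b == i); last by rewrite addr0.
  by case: (eqVneq a v1) => [->|_]; rewrite 1?eq_sym ?(negbTE vv1) /= ?expr0 ?orbF;
     case: (a == v); rewrite // addrC.
have wP v : v != i -> v != v1 -> exists (c : C) (z : 'cV[C]_(nedges n)),
    A *m z = c *: unit_edge C j j' /\
    (z = star_vector i set0 - star_vector i [set v] \/
     z = star_vector i set0 + star_vector i [set v1; v]).
  move=> vi vv1; have [j2 S2] := sN [set v]; have [j3 S3] := sN [set v1; v].
  have AE : A *m star_vector i set0 + A *m star_vector i [set v1; v] =
      A *m star_vector i [set v1] + A *m star_vector i [set v].
    by rewrite -!mulmxDr sumE.
  have j'j : j' != j by rewrite eq_sym.
  have h1 := star_sum AE jj' Sj Sj' S2 S3.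
  have h2 := star_sum (esym AE) j'j Sj' Sj S3 S2.
  have [j2j|j2j] := eqVneq j2 j.
    have j3j' : j3 = j' by move: h2; rewrite j2j (negbTE jj') orbF => /eqP.
    rewrite j2j in S2; rewrite j3j' in S3.
    set z := star_vector i set0 - star_vector i [set v].
    exists (coord (A *m z) j j'), z; split; last by left.
    apply: star_support_meet => // a b aj bj; rewrite mulmxBr.
      by rewrite coordD coordN !(star_multiple_support Sj, star_multiple_support S2) // subrr.
    have -> : A *m star_vector i set0 - A *m star_vector i [set v] =
        A *m star_vector i [set v1] - A *m star_vector i [set v1; v].
      by apply/eqP; rewrite subr_eq addrAC eq_sym subr_eq eq_sym AE.
    by rewrite coordD coordN !(star_multiple_support Sj', star_multiple_support S3) // subrr.
  have j3j : j3 = j by move: h1; rewrite (negbTE j2j) => /eqP.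
  have j2j' : j2 = j' by move: h2; rewrite j3j (negbTE jj') => /eqP.
  rewrite j3j in S3; rewrite j2j' in S2.
  set z := star_vector i set0 + star_vector i [set v1; v].
  exists (coord (A *m z) j j'), z; split; last by right.
  apply: star_support_meet => // a b aj bj; rewrite mulmxDr.
    by rewrite coordD !(star_multiple_support Sj, star_multiple_support S3) // addr0.
  by rewrite AE coordD !(star_multiple_support Sj', star_multiple_support S2) // addr0.
have [s [us s3 sE]] : exists s, [/\ uniq s, size s = 3%N &
    forall u, u \in s -> u \notin [:: i; v1]].
  by apply: extra_vertices.
case: s us s3 sE => [|v2 [|v3 [|v4 []]]] //=.
rewrite !inE !negb_or !andbT => /andP[/andP[n23 n24] n34] _ sE.
have [v2i v21] : v2 != i /\ v2 != v1.
  by apply/andP; have := sE v2; rewrite !inE eqxx negb_or; apply.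
have [v3i v31] : v3 != i /\ v3 != v1.
  by apply/andP; have := sE v3; rewrite !inE eqxx orbT negb_or; apply.
have [v4i v41] : v4 != i /\ v4 != v1.
  by apply/andP; have := sE v4; rewrite !inE eqxx !orbT negb_or; apply.
have [c2 [z2 [A2 D2]]] := wP v2 v2i v21; have [c3 [z3 [A3 D3]]] := wP v3 v3i v31.
have E : c3 *: z2 = c2 *: z3.
  apply: (can_inj (mulKmx A_unit)).
  by rewrite -!scalemxAr A2 A3 !scalerA mulrC.
have cE v : v != i -> c3 * coord z2 i v = c2 * coord z3 i v.
  by move=> vi; rewrite -!coordZ E.
have inj c z : A *m z = c *: unit_edge C j j' -> c = 0 -> z = 0.
  by move=> Az c0; rewrite -(mulKmx A_unit z) Az c0 scale0r mulmx0.
have nat2 : (1 + 1 != 0 :> C) by rewrite -mulr2n pnatr_eq0.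
have cs T v : v != i -> coord (star_vector i T) i v = (-1) ^+ (v \in T).
  by move=> vi; rewrite coord_star ?eqxx // eq_sym.
have n32 : (v3 == v2) = false by rewrite eq_sym (negbTE n23).
have n42 : (v4 == v2) = false by rewrite eq_sym (negbTE n24).
have n43 : (v4 == v3) = false by rewrite eq_sym (negbTE n34).
pose simp := (inE, eqxx, negbTE n23, n32, n42, n43, negbTE v21, negbTE v31,
  negbTE v41, expr0, expr1, opprK, subrr, mulr0).
have coord0 z v t : z = 0 -> coord z i v = t -> t = 0 by move=> ->; rewrite coord0.
have nat2_eq0 (c : C) : c * (1 + 1) = 0 -> c = 0.
  by move/eqP; rewrite mulf_eq0 (negbTE nat2) orbF => /eqP.
(* Each z is either twice the edge vector iv or twice the all-ones star with v1 and v removed.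
   Comparison at v2, or at the untouched leaf v4, makes a factor vanish, and then one of the z
   vanishes, which is absurd. *)
have [x2|x2] := D2; have [x3|x3] := D3; exfalso; apply/negP: nat2; rewrite negbK;
  apply/eqP.
- have /nat2_eq0 c30 : c3 * (1 + 1) = 0.
    by have := cE v2 v2i; rewrite x2 x3 !coordD !coordN !cs // !simp.
  by apply: (coord0 _ v3 _ (inj _ _ A3 c30)); rewrite x3 coordD coordN !cs // !simp.
- have /nat2_eq0 c20 : c2 * (1 + 1) = 0.
    by have := cE v4 v4i; rewrite x2 x3 !coordD !coordN !cs // !simp.
  by apply: (coord0 _ v2 _ (inj _ _ A2 c20)); rewrite x2 coordD coordN !cs // !simp.
- have /nat2_eq0 c30 : c3 * (1 + 1) = 0.
    by have := cE v4 v4i; rewrite x2 x3 !coordD !coordN !cs // !simp.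
  by apply: (coord0 _ v3 _ (inj _ _ A3 c30)); rewrite x3 coordD coordN !cs // !simp.
- have /nat2_eq0 c20 : c2 * (1 + 1) = 0.
    by have := cE v2 v2i; rewrite x2 x3 !coordD !cs // !simp.
  by apply: (coord0 _ v4 _ (inj _ _ A2 c20)); rewrite x2 coordD !cs // !simp.
Qed.

Lemma star_unit_edge i v : v != i ->
  star_vector i set0 - star_vector i [set v] = 2 *: unit_edge C i v.
Proof.
move=> vi; have iv : i != v by rewrite eq_sym.
apply: coord_inj => a b ab; rewrite coordD coordN !coord_star // coordZ coord_unit //.
rewrite pair_set_eq !inE; have [ai|ai] := eqVneq a i.
  rewrite ai (negbTE iv) /= orbF; case: (b == v); rewrite /= ?expr0 ?subrr ?mulr0 //.
  by rewrite expr1 opprK mulr1.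
have [bi|bi] := eqVneq b i; rewrite /= ?andbF ?orbF ?subrr ?mulr0 //.
by case: (a == v); rewrite /= ?expr0 ?expr1 ?opprK ?subrr ?mulr0 ?mulr1.
Qed.

Lemma star_unit_support i : exists j, forall v, v != i ->
  star_support j (A *m unit_edge C i v).
Proof.
have [j Sj] := A_star (@signed_star_vector i set0); exists j => v vi.
have [j' Sj'] := A_star (@signed_star_vector i [set v]).
have jj' := star_center vi Sj Sj'; rewrite -jj' in Sj'.
have -> : unit_edge C i v = 2^-1 *: (star_vector i set0 - star_vector i [set v]).
  by rewrite star_unit_edge // scalerA mulVf ?scale1r // pnatr_eq0.
move=> a b aj bj; rewrite -scalemxAr mulmxBr coordZ coordD coordN.
by rewrite (star_multiple_support Sj) // (star_multiple_support Sj') // subrr mulr0.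
Qed.

(** The images of the stars for [set0] and [[set u]] agree off the edge sigma i, sigma u, so they
    share the square q. On that edge they differ but have equal squares, so they are opposite, and
    half their difference, [c i u], squares to q. *)
Lemma star_unit_sqr (sigma : 'I_n -> 'I_n) (c : 'I_n -> 'I_n -> C) :
    injective sigma ->
    (forall i j, i != j -> c i j != 0) ->
    (forall i j, i != j ->
       A *m unit_edge C i j = c i j *: unit_edge C (sigma i) (sigma j)) ->
  forall i j v, i != j -> i != v -> c i j ^+ 2 = c i v ^+ 2.
Proof.
move=> sI c0 AE i j v ij iv.
have [m [q q0 Sq]] := A_star (@signed_star_vector i set0).
suff cq u : i != u -> c i u ^+ 2 = q by rewrite !cq.
move=> iu; have ui : u != i by rewrite eq_sym.
have [m' [q' q'0 Sq']] := A_star (@signed_star_vector i [set u]).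
have SM : star_multiple m (A *m star_vector i set0) by exists q.
have SM' : star_multiple m' (A *m star_vector i [set u]) by exists q'.
have mm' := star_center ui SM SM'; subst m'.
have siu : sigma i != sigma u by rewrite (inj_eq sI).
have dE a b : coord (A *m star_vector i set0) a b - coord (A *m star_vector i [set u]) a b
    = 2 * c i u * ([set a; b] == [set sigma i; sigma u])%:R.
  rewrite -coordN -coordD -mulmxBr star_unit_edge // -scalemxAr AE //.
  by rewrite !coordZ coord_unit // mulrA.
have [w] := @other_vertex n [:: sigma i; sigma u] (ltnW (ltnW n_ge5)).
rewrite !inE negb_or => /andP[wi wu].
set a := coord (A *m star_vector i set0) (sigma i) (sigma u).
set b := coord (A *m star_vector i [set u]) (sigma i) (sigma u).
have ab : a - b = 2 * c i u by rewrite dE eqxx mulr1.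
have ab0 : a - b != 0 by rewrite ab mulf_neq0 ?pnatr_eq0 ?c0.
have mE : (sigma i == m) || (sigma u == m).
  apply: contraNT ab0; rewrite negb_or => /andP[im um].
  by rewrite /a /b (star_multiple_support SM) // (star_multiple_support SM') // subrr.
have mw : m != w.
  by apply: contraTneq mE => ->; rewrite ![_ == w]eq_sym (negbTE wi) (negbTE wu).
have qq' : q = q'.
  have := Sq m w mw; have := Sq' m w mw; rewrite eqxx !mulr1 => <- <-.
  have := dE m w; rewrite pair_set_eq (negbTE wi) (negbTE wu) !andbF mulr0.
  by move/eqP; rewrite subr_eq0 => /eqP->.
have aq : a ^+ 2 = q by rewrite /a Sq // mE mulr1.
have bq : b ^+ 2 = q by rewrite /b Sq' // mE mulr1 qq'.
have /eqP : a ^+ 2 == b ^+ 2 by rewrite aq bq.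
move/eqP; rewrite eqf_sqr -subr_eq0 (negbTE ab0) /= => /eqP aNb.
rewrite -aq; congr (_ ^+ 2); apply: (@mulfI _ 2); first by rewrite pnatr_eq0.
by rewrite -ab aNb; ring.
Qed.

End StarPreserving.

Lemma autom_signed_star d A : (1 < d)%N -> (d + 2 <= n)%N ->
    lin_automorphism (Lvar d n) A ->
  forall i y, signed_star i y -> exists j, star_multiple j (A *m y).
Proof.
case: d => [|[|k]] // _ kn AL i y yS; have [Au _] := AL.
have y0 : y != 0.
  have [|v] := @other_vertex n [:: i]; first by rewrite /=; lia.
  rewrite inE => vi; apply/eqP => y0; have := yS v i vi; rewrite y0 coord0 eqxx orbT.
  by rewrite expr0n /= => /eqP; rewrite eq_sym oner_eq0.
have [||j [q [q0 zE]]] := @star_classification C n k (A *m y) _ _ (mulmx_neq0 Au y0).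
- by lia.
- by move=> b s x; apply: autom_star_diff3 AL yS.
by exists j, q.
Qed.

Lemma Lvar_automorphism d A : (1 < d)%N -> (d + 2 <= n)%N ->
    lin_automorphism (Lvar d n) A ->
  exists (a : C) (S : 'M[C]_(nedges n)) (sigma : 'S_n),
    [/\ a != 0, is_diag_mx S, (forall k, S k k = 1 \/ S k k = -1) &
        A = a *: (S *m edge_perm_mx sigma)].
Proof.
move=> d1 dn AL; have [Au _] := AL.
have n3 : (2 < n)%N by lia.
have AS := autom_signed_star d1 dn AL.
have BS := autom_signed_star d1 dn (lin_automorphism_inv AL).
have Bu : invmx A \in unitmx by rewrite unitmx_inv.
have [sigma sI /= sE] := vertex_map n3 Au (star_unit_support Au AS) (star_unit_support Bu BS).
pose c i j := coord (A *m unit_edge C i j) (sigma i) (sigma j).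
have AE i j : i != j -> c i j != 0 /\
    A *m unit_edge C i j = c i j *: unit_edge C (sigma i) (sigma j).
  move=> ij; have [c0 c00 c0E] := sE i j ij.
  by rewrite /c c0E coordZ coord_unitxx ?mulr1 // (inj_eq sI).
have c0 i j ij := (AE i j ij).1; have {}AE i j ij := (AE i j ij).2.
exact: (signed_permutation n3 sI c0 AE (star_unit_sqr Au AS sI c0 AE)).
Qed.

End StarAutomorphisms.

(** * Products of linear forms *)

Section LinearForms.
Variable C : numClosedFieldType.

Definition form m (w : 'rV[C]_m) (x : 'cV[C]_m) : C := (w *m x) 0 0.

Lemma formE m (w : 'rV[C]_m) x : form w x = \sum_k w 0 k * x k 0.
Proof. by rewrite /form mxE. Qed.

Lemma formDr m (w : 'rV[C]_m) x y : form w (x + y) = form w x + form w y.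
Proof. by rewrite /form mulmxDr mxE. Qed.

Lemma formZr m (w : 'rV[C]_m) c x : form w (c *: x) = c * form w x.
Proof. by rewrite /form -scalemxAr mxE. Qed.

Lemma formDl m (w w' : 'rV[C]_m) x : form (w + w') x = form w x + form w' x.
Proof. by rewrite /form mulmxDl mxE. Qed.

Lemma formNl m (w : 'rV[C]_m) x : form (- w) x = - form w x.
Proof. by rewrite /form mulNmx mxE. Qed.

Lemma form_neq0 m (w : 'rV[C]_m) : w != 0 -> exists x, form w x != 0.
Proof.
move=> w0; have [k wk] : exists k, w 0 k != 0.
  have [/existsP//|h] := boolP [exists k, w 0 k != 0].
  case/eqP: w0; apply/rowP => k; rewrite mxE; apply/eqP.
  by apply: contraNT h => wk; apply/existsP; exists k.
exists (delta_mx k 0); rewrite formE (bigD1 k) //= big1 ?addr0.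
  by rewrite mxE !eqxx mulr1.
by move=> l lk; rewrite mxE (negbTE lk) mulr0.
Qed.

(** On the line x + s y each form restricts to a nonzero polynomial in s, so some s avoids the roots
    of their product. *)
Lemma forms_common_nonzero m (ws : seq 'rV[C]_m) :
  (forall w, w \in ws -> w != 0) -> exists x, forall w, w \in ws -> form w x != 0.
Proof.
elim: ws => [|w ws IH] ws0; first by exists 0.
have [x xE] : exists x, forall w, w \in ws -> form w x != 0.
  by apply: IH => w' w'ws; apply: ws0; rewrite inE w'ws orbT.
have [y yE] := form_neq0 (ws0 w (mem_head _ _)).
pose P := \prod_(w' <- w :: ws) ((form w' x)%:P + (form w' y) *: 'X).
have [|s Ps] := @nonroot C P.
  rewrite prodf_seq_neq0; apply/allP => w' w'ws /=.
  have [fy|fy] := eqVneq (form w' y) 0.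
    rewrite fy scale0r addr0 polyC_eq0; apply: xE; move: w'ws; rewrite inE.
    by case: eqP => [w'w|//]; rewrite w'w in fy; rewrite fy eqxx in yE.
  apply/eqP => /(congr1 (fun p : {poly C} => p`_1)).
  by rewrite coefD coefC coefZ coefX coef0 /= add0r mulr1 => /eqP; rewrite (negbTE fy).
exists (x + s *: y) => w' w'ws; rewrite formDr formZr.
apply: contraNneq Ps => E; rewrite horner_prod prodf_seq_eq0; apply/hasP.
by exists w' => //=; rewrite hornerD hornerC hornerZ hornerX mulrC E.
Qed.

Lemma forms_vanish m r (I : finType) (w : I -> 'rV[C]_m) (M : 'M[C]_(m, r)) :
  (forall x, \prod_i form (w i) (M *m x) = 0) -> exists i, w i *m M = 0.
Proof.
move=> wM; have [/existsP[i /eqP ?]|h] := boolP [exists i, w i *m M == 0].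
  by exists i.
have [|x xE] := @forms_common_nonzero r [seq w i *m M | i : I].
  move=> _ /imageP[i _ ->]; apply: contraNneq h => wi.
  by apply/existsP; exists i; rewrite wi.
have /eqP := wM x; case/prodf_eq0 => i _; rewrite /form mulmxA.
by rewrite -/(form _ _) (negbTE (xE _ _)) // image_f.
Qed.

End LinearForms.

(** * Cycles of the complete graph and quadruples of linear forms *)

Section TriangleForms.
Variables (C : numClosedFieldType) (n : nat).
Implicit Types (w : 'rV[C]_(nedges n)) (u v : 'I_n) (k l : 'I_(nedges n)).

(** Its image is the space of signed lengths of configurations on a line; its left kernel is the
    cycle space of K_n. *)
Definition incidence : 'M[C]_(nedges n, n) :=
  \matrix_(k, u) ((u == (val (edge_of k)).1)%:R - (u == (val (edge_of k)).2)%:R).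

Lemma incidence_notin k u : u \notin edge_set (edge_of k) -> incidence k u = 0.
Proof.
by rewrite !inE negb_or => /andP[/negbTE u1 /negbTE u2]; rewrite mxE u1 u2 subrr.
Qed.

Lemma incidence_sqr k u : u \in edge_set (edge_of k) -> incidence k u ^+ 2 = 1.
Proof.
have := valP (edge_of k); rewrite /= ltn_neqAle => /andP[k12 _].
rewrite !inE mxE => /orP[]/eqP->; rewrite eqxx -val_eqE /=.
  by rewrite (negbTE k12) subr0 expr1n.
by rewrite eq_sym (negbTE k12) sub0r sqrrN expr1n.
Qed.

Lemma edge_other k u : u \in edge_set (edge_of k) ->
  exists2 v, v != u & edge_set (edge_of k) = [set u; v].
Proof.
have [a [b [ab ->]]] := edge_ends k; rewrite !inE => /orP[]/eqP->.
  by exists b; rewrite // eq_sym.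
by exists a; rewrite // setUC.
Qed.

Lemma cycle_vertex w u : w *m incidence = 0 -> \sum_k w 0 k * incidence k u = 0.
Proof. by move/rowP/(_ u); rewrite !mxE. Qed.

Lemma cycle_next w k u : w *m incidence = 0 -> w 0 k != 0 ->
    u \in edge_set (edge_of k) ->
  exists l, [/\ l != k, u \in edge_set (edge_of l) & w 0 l != 0].
Proof.
move=> /(cycle_vertex u) w0 wk uk.
have [/existsP[l /and3P[? ? ?]]|h] :=
  boolP [exists l, [&& l != k, u \in edge_set (edge_of l) & w 0 l != 0]].
  by exists l.
move: w0; rewrite (bigD1 k) //= big1 ?addr0 => [/eqP|l lk].
  rewrite mulf_eq0 (negbTE wk) /= -sqrf_eq0 incidence_sqr // oner_eq0 //.
have [ul|/incidence_notin->] := boolP (u \in edge_set (edge_of l)); last by rewrite mulr0.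
have [->|wl] := eqVneq (w 0 l) 0; first by rewrite mul0r.
by case/existsP: h; exists l; rewrite lk ul wl.
Qed.

Lemma cycle_sqr w k l u : w *m incidence = 0 -> k != l ->
    u \in edge_set (edge_of k) -> u \in edge_set (edge_of l) ->
    (forall m, m != k -> m != l -> u \in edge_set (edge_of m) -> w 0 m = 0) ->
  w 0 k ^+ 2 = w 0 l ^+ 2.
Proof.
move=> /(cycle_vertex u) w0 kl uk ul wm.
move: w0; rewrite (bigD1 k) //= (bigD1 l) 1?eq_sym //= big1 ?addr0 => [E|m /andP[mk ml]].
  rewrite -[LHS]mulr1 -[RHS]mulr1 -{1}(incidence_sqr uk) -(incidence_sqr ul).
  by rewrite -!exprMn; apply/eqP; rewrite eqf_sqr -addr_eq0 E eqxx orbT.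
have [um|/incidence_notin->] := boolP (u \in edge_set (edge_of m)); last by rewrite mulr0.
by rewrite wm ?mul0r.
Qed.

(** Balance at a vertex forbids a support edge with a free end, so at most three support edges must
    close up to a triangle. At a vertex with two support edges, balance makes their squares
    equal. *)
Lemma short_cycle w :
    w != 0 -> w *m incidence = 0 ->
    (forall s : seq 'I_(nedges n), uniq s -> all (fun k => w 0 k != 0) s ->
       (size s <= 3)%N) ->
  exists (T : {set 'I_n}) k0 k1 k2,
    [/\ #|T| = 3%N, uniq [:: k0; k1; k2],
        (forall l, (w 0 l != 0) = (l \in [:: k0; k1; k2])),
        (forall l, l \in [:: k0; k1; k2] -> edge_set (edge_of l) \subset T) &
        (forall l, l \in [:: k0; k1; k2] -> w 0 l ^+ 2 = w 0 k0 ^+ 2)].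
Proof.
move=> nzw wD small.
have [k0 wk0] : exists k, w 0 k != 0.
  have [/existsP//|h] := boolP [exists k, w 0 k != 0].
  case/eqP: nzw; apply/rowP => k; rewrite mxE; apply/eqP.
  by apply: contraNT h => wk; apply/existsP; exists k.
have [u [v [uv k0E]]] := edge_ends k0.
have [|k1 [k10 vk1 wk1]] := cycle_next (u := v) wD wk0; first by rewrite k0E !inE eqxx orbT.
have [|k2 [k20 uk2 wk2]] := cycle_next (u := u) wD wk0; first by rewrite k0E !inE eqxx.
have [p pv k1E] := edge_other vk1; have [p' p'u k2E] := edge_other uk2.
have pu : p != u.
  apply: contraNneq k10 => pu; apply/eqP/edge_set_inj => /=.
  by rewrite k0E k1E pu setUC.
have p'v : p' != v.
  apply: contraNneq k20 => p'v; apply/eqP/edge_set_inj => /=.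
  by rewrite k0E k2E p'v.
have k12 : k1 != k2.
  apply: contraTneq uk2 => <-; rewrite k1E !inE negb_or uv eq_sym //.
have unk : uniq [:: k0; k1; k2].
  by rewrite /= !inE negb_or !andbT k12 [k0 == _]eq_sym k10 eq_sym k20.
have supp l : (w 0 l != 0) = (l \in [:: k0; k1; k2]).
  apply/idP/idP => [wl|]; last by rewrite !inE => /or3P[]/eqP->.
  apply: contraT => lk; have := small (l :: [:: k0; k1; k2]).
  by rewrite cons_uniq lk unk [all _ _]/= wl wk0 wk1 wk2 => /(_ isT isT).
have p'p : p' = p.
  have [|l [lk1 pl wl]] := cycle_next (u := p) wD wk1; first by rewrite k1E !inE eqxx orbT.
  move: wl; rewrite supp !inE (negbTE lk1) /= => /orP[]/eqP lE; move: pl; rewrite lE.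
    by rewrite k0E !inE (negbTE pu) (negbTE pv).
  by rewrite k2E !inE (negbTE pu) eq_sym => /eqP.
subst p'; exists [set u; v; p], k0, k1, k2; split=> //.
- rewrite setUC cardsU1 cards2 !inE negb_or pu pv uv //.
- move=> l; rewrite !inE => /or3P[]/eqP->; rewrite ?k0E ?k1E ?k2E;
  apply/subsetP => a; rewrite !inE => /orP[]/eqP->; by rewrite eqxx ?orbT.
have wz m : m \notin [:: k0; k1; k2] -> w 0 m = 0.
  by rewrite -supp negbK => /eqP.
move=> l; rewrite !inE => /or3P[]/eqP-> //.
- apply: (cycle_sqr (u := v)) wD k10 vk1 _ _; first by rewrite k0E !inE eqxx orbT.
  move=> m m1 m0 vm; have [mE|mE] := eqVneq m k2; last by rewrite wz // !inE !negb_or m0 m1.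
  by move: vm; rewrite mE k2E !inE eq_sym (negbTE uv) eq_sym (negbTE p'v).
- apply: (cycle_sqr (u := u)) wD k20 uk2 _ _; first by rewrite k0E !inE eqxx.
  move=> m m2 m0 um; have [mE|mE] := eqVneq m k1; last by rewrite wz // !inE !negb_or m0 m2 mE.
  by move: um; rewrite mE k1E !inE (negbTE uv) eq_sym (negbTE p'u).
Qed.

(** Once a i0 has three support coordinates, flipping different ones gives different members of the
    family, none of them a i0. With four forms in all, the support has at most three edges, hence is
    a triangle, and the family is a i0 with its three flips up to factors. The zero sum forces each
    factor to be -1, so two forms add up to a multiple of one coordinate. *)
Lemma four_forms (a : 'I_4 -> 'rV[C]_(nedges n)) i0 :
    a i0 != 0 -> a i0 *m incidence = 0 -> \sum_j a j = 0 ->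
    (forall k, exists j (c : C), forall l,
       a j 0 l = c * (if l == k then - a i0 0 l else a i0 0 l)) ->
    (forall j, a j != 0) ->
  exists (T : {set 'I_n}) (q : C), [/\ #|T| = 3%N, q != 0 &
    forall j j', j != j' -> exists k c, [/\ edge_set (edge_of k) \subset T,
      c ^+ 2 = q & forall l, a j 0 l + a j' 0 l = 2 * c * (l == k)%:R]].
Proof.
move=> nzw wD asum flips nza; set w := a i0 in nzw wD flips.
have /fin_all_exists[J /fin_all_exists[c aE]] := flips.
have c0 k : c k != 0.
  apply: contraNneq (nza (J k)) => ck; apply/eqP/rowP => l.
  by rewrite aE ck mul0r mxE.
have Ji0 k l : w 0 k != 0 -> w 0 l != 0 -> l != k -> J k != i0.
  move=> wk wl lk; apply/eqP => Jk; have := aE k k; have := aE k l.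
  rewrite Jk -/w eqxx (negbTE lk) => El; have c1 : c k = 1.
    by apply: (mulIf wl); rewrite mul1r -El.
  rewrite c1 mul1r => /eqP; rewrite -subr_eq0 opprK -mulr2n mulrn_eq0 /=.
  by rewrite (negbTE wk).
have Jinj k k' l : w 0 k != 0 -> w 0 k' != 0 -> w 0 l != 0 -> uniq [:: k; k'; l] ->
    J k != J k'.
  move=> wk wk' wl; rewrite /= !inE negb_or !andbT => /andP[/andP[kk' kl] k'l].
  apply/eqP => JJ; have := aE k l; have := aE k k; rewrite JJ !aE !eqxx.
  rewrite ![l == _]eq_sym (negbTE kk') (negbTE kl) (negbTE k'l) => Ek El.
  have cc : c k' = c k by apply: (mulIf wl).
  move: Ek; rewrite cc => /(mulfI (c0 k))/eqP; rewrite -subr_eq0 opprK -mulr2n.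
  by rewrite mulrn_eq0 /= (negbTE wk).
have four (s : seq 'I_4) : uniq s -> (size s <= 4)%N.
  by move/card_uniqP <-; rewrite -[X in (_ <= X)%N](card_ord 4) max_card.
have small (s : seq 'I_(nedges n)) :
    uniq s -> all (fun k => w 0 k != 0) s -> (size s <= 3)%N.
  rewrite leqNgt => us ws; apply/negP => s3.
  case: s us ws s3 => [|k0 [|k1 [|k2 [|k3 s]]]] //=.
  rewrite !inE !negb_or => us /and5P[w0 w1 w2 w3 _] _.
  case/and5P: us => /and4P[n01 n02 n03 _] /and3P[n12 n13 _] /andP[n23 _] _ _.
  suff: (5 <= 4)%N by [].
  apply: (four [:: i0; J k0; J k1; J k2; J k3]).
  have N k l m : w 0 k != 0 -> w 0 l != 0 -> w 0 m != 0 -> k != l -> k != m -> l != m ->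
    J k != J l.
    by move=> wk wl wm kl km lm; apply: (Jinj k l m) => //=; rewrite !inE negb_or kl km lm.
  have n10 : k1 != k0 by rewrite eq_sym.
  have n20 : k2 != k0 by rewrite eq_sym.
  have n21 : k2 != k1 by rewrite eq_sym.
  have n30 : k3 != k0 by rewrite eq_sym.
  have n31 : k3 != k1 by rewrite eq_sym.
  have n32 : k3 != k2 by rewrite eq_sym.
  rewrite /= !inE !negb_or !andbT ![i0 == _]eq_sym.
  rewrite (Ji0 k0 k1) // (Ji0 k1 k0) // (Ji0 k2 k0) // (Ji0 k3 k0) //.
  rewrite (N k0 k1 k2) // (N k0 k2 k1) // (N k0 k3 k1) //.
  by rewrite (N k1 k2 k3) // (N k1 k3 k2) // (N k2 k3 k1).
have [T [k0 [k1 [k2 [T3 unk supp kT wsq]]]]] := short_cycle nzw wD small.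
have w0 : w 0 k0 != 0 by rewrite supp !inE eqxx.
have w1 : w 0 k1 != 0 by rewrite supp !inE eqxx orbT.
have w2 : w 0 k2 != 0 by rewrite supp !inE eqxx !orbT.
have [n01 n02 n12] : [/\ k0 != k1, k0 != k2 & k1 != k2].
  by move: unk; rewrite /= !inE negb_or !andbT => /andP[/andP[]].
have n10 : k1 != k0 by rewrite eq_sym.
have n20 : k2 != k0 by rewrite eq_sym.
have n21 : k2 != k1 by rewrite eq_sym.
have J01 : J k0 != J k1 by apply: (Jinj k0 k1 k2).
have J02 : J k0 != J k2.
  by apply: (Jinj k0 k2 k1) => //=; rewrite !inE negb_or n02 n01 n21.
have J12 : J k1 != J k2.
  by apply: (Jinj k1 k2 k0) => //=; rewrite !inE negb_or n12 n10 n20.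
have uJ : uniq [:: i0; J k0; J k1; J k2].
  rewrite /= !inE !negb_or !andbT ![i0 == _]eq_sym J01 J02 J12.
  by rewrite (Ji0 k0 k1) // (Ji0 k1 k0) // (Ji0 k2 k0).
have allJ j : j \in [:: i0; J k0; J k1; J k2].
  apply: contraT => jJ; have := four (j :: [:: i0; J k0; J k1; J k2]).
  by rewrite cons_uniq jJ uJ => /(_ isT).
have sumJ l : a i0 0 l + (a (J k0) 0 l + (a (J k1) 0 l + a (J k2) 0 l)) = 0.
  have := congr1 (fun b : 'rV_(nedges n) => b 0 l) asum; rewrite summxE mxE => <-.
  rewrite -big_enum (perm_big [:: i0; J k0; J k1; J k2]) /=; last first.
    apply: uniq_perm => //; first exact: enum_uniq.
    by move=> j; rewrite mem_enum allJ.
  by rewrite !big_cons big_nil addr0.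
have lin l (t : C) : w 0 l != 0 -> w 0 l * t = 0 -> t = 0.
  by move=> wl /eqP; rewrite mulf_eq0 (negbTE wl) => /eqP.
have e0 : 1 - c k0 + c k1 + c k2 = 0.
  apply: (lin k0) => //; rewrite -[RHS](sumJ k0) !aE eqxx (negbTE n01) (negbTE n02).
  by rewrite -/w; ring.
have e1 : 1 + c k0 - c k1 + c k2 = 0.
  apply: (lin k1) => //; rewrite -[RHS](sumJ k1) !aE eqxx (negbTE n10) (negbTE n12).
  by rewrite -/w; ring.
have e2 : 1 + c k0 + c k1 - c k2 = 0.
  apply: (lin k2) => //; rewrite -[RHS](sumJ k2) !aE eqxx (negbTE n20) (negbTE n21).
  by rewrite -/w; ring.
have half (t : C) : 2 * t = 0 -> t = 0.
  by move/eqP; rewrite mulf_eq0 pnatr_eq0 /= => /eqP.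
have c2E : c k2 = -1.
  by apply/eqP; rewrite -addr_eq0; apply/eqP/half; rewrite -[RHS](addr0 0) -{1}e0 -e1; ring.
have c1E : c k1 = -1.
  by apply/eqP; rewrite -addr_eq0; apply/eqP/half; rewrite -[RHS](addr0 0) -{1}e0 -e2; ring.
have c0E : c k0 = -1.
  by apply/eqP; rewrite -addr_eq0; apply/eqP/half; rewrite -[RHS](addr0 0) -{1}e1 -e2; ring.
exists T, (w 0 k0 ^+ 2); split=> //; first by rewrite sqrf_eq0.
pose good j j' := exists k c, [/\ edge_set (edge_of k) \subset T,
  c ^+ 2 = w 0 k0 ^+ 2 & forall l, a j 0 l + a j' 0 l = 2 * c * (l == k)%:R].
have goodC j j' : good j j' -> good j' j.
  by case=> k [b [kT' b2 ab]]; exists k, b; split=> // l; rewrite addrC.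
have good0 k : k \in [:: k0; k1; k2] -> c k = -1 -> good i0 (J k).
  move=> kk ck; exists k, (w 0 k); split; [exact: kT|exact: wsq|move=> l].
  by rewrite aE ck -/w; case: eqP => [->|_] /=; ring.
have good1 k k' k'' : k'' \in [:: k0; k1; k2] -> c k = -1 -> c k' = -1 ->
    uniq [:: k; k'; k''] -> (forall l, (w 0 l != 0) = (l \in [:: k; k'; k''])) ->
    good (J k) (J k').
  move=> kk ck ck' uk sk; exists k'', (- w 0 k''); split; first exact: kT.
    by rewrite sqrrN wsq.
  move=> l; rewrite !aE ck ck'; move: uk; rewrite /= !inE negb_or !andbT.
  case/andP=> /andP[kk' kk''] k'k''.
  have [->|lk] := eqVneq l k; first by rewrite (negbTE kk') (negbTE kk'') /=; ring.
  have [->|lk'] := eqVneq l k'; first by rewrite (negbTE k'k'') /=; ring.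
  have [->|lk''] := eqVneq l k''; first by rewrite /=; ring.
  have := sk l; rewrite !inE (negbTE lk) (negbTE lk') (negbTE lk'') => /negbFE/eqP->.
  by rewrite /=; ring.
have g0 : good i0 (J k0) by apply: good0; rewrite // !inE eqxx.
have g1 : good i0 (J k1) by apply: good0; rewrite // !inE eqxx orbT.
have g2 : good i0 (J k2) by apply: good0; rewrite // !inE eqxx !orbT.
have g01 : good (J k0) (J k1).
  by apply: (good1 k0 k1 k2) => //; rewrite !inE eqxx !orbT.
have g02 : good (J k0) (J k2).
  apply: (good1 k0 k2 k1) => //; first by rewrite !inE eqxx orbT.
    by rewrite /= !inE negb_or n02 n01 n21.
  by move=> l; rewrite supp !inE [(l == k1) || _]orbC.
have g12 : good (J k1) (J k2).
  apply: (good1 k1 k2 k0) => //; first by rewrite !inE eqxx.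
    by rewrite /= !inE negb_or n12 n10 n20.
  by move=> l; rewrite supp !inE orbA orbC orbA orbC orbA orbC.
move=> j j' jj'; rewrite -/(good j j'); move: jj'; have := allJ j; have := allJ j'.
rewrite !inE => /or4P[]/eqP-> /or4P[]/eqP->; rewrite ?eqxx // => _; first [exact|exact: goodC].
Qed.

End TriangleForms.

(** * The case d = 1: Heron forms and triangles *)

Section LineAutomorphisms.
Variables (C : numClosedFieldType) (n : nat).
Implicit Types (A : 'M[C]_(nedges n)) (x : 'cV[C]_(nedges n)).
Implicit Types (i j u v : 'I_n) (k l : 'I_(nedges n)) (T : {set 'I_n}).

Lemma Lvar_incidence (p : 'cV[C]_n) : Lvar 1 n (incidence C n *m p).
Proof.
exists p; apply/colP => k; rewrite !mxE big_ord_recl big_ord0 addr0; congr (_ ^+ 2).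
under eq_bigr => u _ do rewrite mxE mulrBl.
rewrite sumrB (bigD1 (val (edge_of k)).1) //= eqxx mul1r big1 ?addr0; last first.
  by move=> u /negbTE->; rewrite mul0r.
rewrite (bigD1 (val (edge_of k)).2) //= eqxx mul1r big1 ?addr0 //.
by move=> u /negbTE->; rewrite mul0r.
Qed.

Lemma flip_mulmx S x :
  flip S x = diag_mx (\row_l (if l \in S then -1 else 1)) *m x.
Proof.
by apply/colP => l; rewrite mul_diag_mx !mxE; case: ifP; rewrite ?mulN1r ?mul1r.
Qed.

Lemma poly_lt_form (w : 'rV[C]_(nedges n)) : poly_lt 2 (form w).
Proof.
apply: PolyLtE (poly_lt_sum (index_enum 'I_(nedges n))
  (fun l => poly_ltZ (w 0 l) (poly_lt_coord C l))) _ => x.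
by rewrite formE.
Qed.

Lemma form_row A k x : form (row k A) x = (A *m x) k 0.
Proof. by rewrite /form -row_mul mxE. Qed.

Lemma triangle_rows A (a b c : 'I_n) :
    lin_automorphism (Lvar 1 n) A -> uniq [:: a; b; c] ->
  exists T (q : C), [/\ #|T| = 3%N, q != 0 &
    forall k, edge_set (edge_of k) \subset [set a; b; c] ->
      exists k' r, [/\ edge_set (edge_of k') \subset T, r ^+ 2 = q &
        forall x, (A *m x) k 0 = r * x k' 0]].
Proof.
move=> AL; have [Au [AV _]] := AL.
rewrite /= !inE negb_or !andbT => /andP[/andP[ab ac] bc].
have [kX kXE] := edge_indexP ab; have [kY kYE] := edge_indexP bc.
have [kZ kZE] := edge_indexP ac.
have XY : (kX == kY) = false.
  apply/negbTE/eqP => E; move/eqP: kYE; rewrite -E kXE pair_set_eq.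
  by rewrite (negbTE ab) (negbTE ac).
have XZ : (kX == kZ) = false.
  apply/negbTE/eqP => E; move/eqP: kZE; rewrite -E kXE pair_set_eq.
  by rewrite (negbTE bc) (negbTE ac) andbF.
have YZ : (kY == kZ) = false.
  apply/negbTE/eqP => E; move/eqP: kZE; rewrite -E kYE pair_set_eq.
  by rewrite eq_sym (negbTE ab) (negbTE bc).
pose X := row kX A; pose Y := row kY A; pose Z := row kZ A.
(* The four Heron factors, with signs making their sum zero and the sums of form 0 with forms 3, 2,
   1 equal to 2X, 2Y, 2Z. *)
pose w (j : 'I_4) := nth 0 [:: X + Y + Z; - X - Y + Z; - X + Y - Z; X - Y - Z] j.
pose F x := \prod_j form (w j) x.
have FE x : F x = ((A *m x) kZ 0 ^+ 2) ^+ 2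
    - 2 * (A *m x) kZ 0 ^+ 2 * ((A *m x) kX 0 ^+ 2 + (A *m x) kY 0 ^+ 2)
    + ((A *m x) kX 0 ^+ 2 - (A *m x) kY 0 ^+ 2) ^+ 2.
  rewrite /F !big_ord_recr big_ord0 /= /w /= !(formDl, formNl) !form_row; ring.
have F0 x : Lvar 1 n x -> F x = 0.
  move/AV => [p /colP pE]; rewrite FE.
  have sqE k i j : edge_set (edge_of k) = [set i; j] ->
      (A *m x) k 0 ^+ 2 = (p i 0 - p j 0) ^+ 2.
    move=> kE; rewrite -(coord_edge _ kE) -coord_sqmap.
    have -> : sqmap (A *m x) = meas p by apply/colP.
    by rewrite coord_meas big_ord_recl big_ord0 addr0.
  by rewrite (sqE kX a b) // (sqE kY b c) // (sqE kZ a c) //; ring.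
have Feven S x : F (flip S x) = F x.
  have [||g [_ _ gE]] := @Lvar_even C n 1 _ F _ F0 => //.
    have := poly_lt_prod (enum 'I_4) (fun t => poly_lt_form (w t)).
    by rewrite size_enum_ord => /PolyLtE; apply => y; rewrite big_enum.
  by rewrite !gE sqmap_flip.
have wsum : \sum_j w j = 0.
  by rewrite !big_ord_recr big_ord0 /= /w /=; apply/rowP => l; rewrite !mxE; ring.
have nzw (t : 'I_4) : w t != 0.
  apply/eqP => wt; have: form (w t) (invmx A *m delta_mx kX 0) ^+ 2 = 1.
    rewrite /w; case: t {wt} => [[|[|[|[|]]]] //= _];
    rewrite !(formDl, formNl) !form_row !mulKVmx // !mxE !eqxx ![_ == kX]eq_sym XY XZ /=; ring.
  rewrite wt /form mul0mx mxE expr0n => /eqP.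
  by rewrite eq_sym oner_eq0.
have [i0 wD] : exists t, w t *m incidence C n = 0.
  by apply: forms_vanish => p; apply: F0; apply: Lvar_incidence.
have flips k : exists t (r : C), forall l,
    w t 0 l = r * (if l == k then - w i0 0 l else w i0 0 l).
  have [y wy] := form_neq0 (nzw i0).
  pose v := (form (w i0) y)^-1 *: y.
  have wv : w i0 *m v = 1%:M.
    by apply/matrixP => i1 i2; rewrite !ord1 -[LHS]/(form _ _) formZr mulVf // mxE.
  pose M := diag_mx (\row_l (if l \in [set k] then -1 else 1 : C)).
  (* The matrix projects onto the kernel of [w i0] and then flips k. By evenness [F] vanishes on its
     image, so some [w t *m M] vanishes on that kernel and is a multiple of [w i0]. *)
  have [|t tE] := @forms_vanish _ _ _ _ w (M *m (1%:M - v *m w i0)).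
    move=> x; rewrite -mulmxA -flip_mulmx -/(F _) Feven /F (bigD1 i0) //= /form.
    by rewrite mulmxA mulmxBr mulmx1 mulmxA wv mul1mx subrr mul0mx mxE mul0r.
  exists t, ((w t *m M *m v) 0 0) => l.
  move: tE; rewrite mulmxA mulmxBr mulmx1 mulmxA => /eqP; rewrite subr_eq0 => /eqP/rowP/(_ l).
  have -> : (w t *m M) 0 l = w t 0 l * (if l == k then -1 else 1).
    by rewrite mul_mx_diag !mxE inE.
  rewrite [RHS]mxE big_ord_recl big_ord0 addr0.
  case: eqP => _ E; last by rewrite -E mulr1.
  by rewrite mulrN -E mulrN1 opprK.
have [T [q [T3 q0 TE]]] := four_forms (nzw i0) wD wsum flips nzw.
exists T, q; split=> // k kT.
have rowP2 (R : 'rV[C]_(nedges n)) (j j' : 'I_4) : j != j' -> w j + w j' = 2 *: R ->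
    R = row k A ->
  exists k' r, [/\ edge_set (edge_of k') \subset T, r ^+ 2 = q &
        forall x, (A *m x) k 0 = r * x k' 0].
  move=> jj' ww RE; have [k' [r [k'T r2 rE]]] := TE j j' jj'; exists k', r; split=> // x.
  have Rl l : R 0 l = r * (l == k')%:R.
    apply: (@mulfI _ 2); first by rewrite pnatr_eq0.
    have := congr1 (fun t : 'rV_(nedges n) => t 0 l) ww.
    by rewrite !mxE => <-; rewrite rE mulrA.
  rewrite -form_row -RE formE (bigD1 k') //= Rl eqxx mulr1 big1 ?addr0 // => l lk.
  by rewrite Rl (negbTE lk) mulr0 mul0r.
have kXYZ : k \in [:: kX; kY; kZ].
  have [i [j [ij kE]]] := edge_ends k; move: kT; rewrite kE subUset !sub1set !inE.
  have kE' k' i' j' : edge_set (edge_of k') = [set i'; j'] ->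
      [set i; j] == [set i'; j'] -> k == k'.
    by move=> k'E /eqP ijE; apply/eqP/edge_set_inj; rewrite /= kE k'E.
  rewrite -!orbA => /andP[/or3P[]/eqP iE /or3P[]/eqP jE];
    first [by rewrite iE jE eqxx in ij
          |by rewrite (kE' kX a b) ?iE ?jE ?pair_set_eq ?eqxx ?orbT
          |by rewrite (kE' kY b c) ?iE ?jE ?pair_set_eq ?eqxx ?orbT
          |by rewrite (kE' kZ a c) ?iE ?jE ?pair_set_eq ?eqxx ?orbT].
move: kXYZ; rewrite !inE => /or3P[]/eqP kE.
- apply: (rowP2 X 0 3) => //; last by rewrite kE.
  by rewrite /w /=; apply/rowP => l; rewrite !mxE; ring.
- apply: (rowP2 Y 0 2) => //; last by rewrite kE.
  by rewrite /w /=; apply/rowP => l; rewrite !mxE; ring.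
- apply: (rowP2 Z 0 1) => //; last by rewrite kE.
  by rewrite /w /=; apply/rowP => l; rewrite !mxE; ring.
Qed.

Hypothesis n_ge3 : (2 < n)%N.

(** Rows of the inverse are what is needed: applying [triangle_rows] to it gives x_k = r_k (A
    x)_{phi k} for all x, from which the columns of A are read off. *)
Lemma edge_permutation A : lin_automorphism (Lvar 1 n) A ->
  exists (phi : 'I_(nedges n) -> 'I_(nedges n)) (r : 'I_(nedges n) -> C),
    [/\ injective phi, (forall k, r k != 0),
        (forall k, A *m delta_mx k 0 = (r k)^-1 *: delta_mx (phi k) 0 :> 'cV_(nedges n)) &
        forall a b c, uniq [:: a; b; c] -> exists T (q : C), #|T| = 3%N /\
          forall k, edge_set (edge_of k) \subset [set a; b; c] ->
            edge_set (edge_of (phi k)) \subset T /\ r k ^+ 2 = q].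
Proof.
move=> AL; have [Au _] := AL; have BL := lin_automorphism_inv AL.
have rows k : exists k' (r : C), r != 0 /\ forall x, (invmx A *m x) k 0 = r * x k' 0.
  have [i [j [ij kE]]] := edge_ends k.
  have [|v] := @other_vertex n [:: i; j]; first by [].
  rewrite !inE negb_or => /andP[vi vj].
  have [|T [q [_ q0 TE]]] := @triangle_rows _ i j v BL.
    by rewrite /= !inE negb_or ij ![_ == v]eq_sym vi vj.
  have [|k' [r [_ rq rE]]] := TE k; first by rewrite kE subsetUl.
  by exists k', r; split=> //; rewrite -sqrf_eq0 rq.
have /fin_all_exists[phi /fin_all_exists[r rP]] := rows.
have r0 k := (rP k).1; have rE k x := (rP k).2 x; have {rP}AE k x : x k 0 = r k * (A *m x) (phi k) 0.
  by rewrite -rE mulKmx.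
have phiI : injective phi.
  move=> k l kl; apply/eqP; apply: contraT => ne.
  have := AE k (delta_mx k 0); have := AE l (delta_mx k 0).
  rewrite kl !mxE !eqxx [l == k]eq_sym (negbTE ne) => /esym/eqP.
  by rewrite mulf_eq0 (negbTE (r0 l)) => /eqP->; rewrite mulr0 => /eqP; rewrite oner_eq0.
exists phi, r; split=> // [k|a b c abc].
  apply/colP => l'; have [psi _ psiK] := injF_bij phiI.
  rewrite -[l']psiK; move: (psi l') => l.
  apply: (mulfI (r0 l)); rewrite -AE !mxE (inj_eq phiI) !eqxx !andbT.
  by case: eqP => [->|_]; rewrite ?mulr1 ?mulfV ?mulr0.
have [T [q [T3 q0 TE]]] := triangle_rows BL abc; exists T, q; split=> // k kT.
have [k' [s [k'T sq sE]]] := TE k kT.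
have s0 : s != 0 by rewrite -sqrf_eq0 sq.
have kk' : phi k = k'.
  apply/eqP; apply: contraT => ne; have := rE k (delta_mx (phi k) 0).
  rewrite sE !mxE !eqxx eq_sym (negbTE ne) mulr0 mulr1 => /esym/eqP.
  by rewrite (negbTE (r0 k)).
split; first by rewrite kk'.
have := rE k (delta_mx k' 0); rewrite sE kk' mxE !eqxx !mulr1 => <-; exact: sq.
Qed.

Lemma two_subsets_meet (T E1 E2 : {set 'I_n}) : #|T| = 3%N -> E1 \subset T ->
  E2 \subset T -> #|E1| = 2%N -> #|E2| = 2%N -> exists j, j \in E1 :&: E2.
Proof.
move=> T3 E1T E2T c1 c2; apply/set0Pn; rewrite -card_gt0.
have := cardsUI E1 E2; have : (#|E1 :|: E2| <= #|T|)%N by rewrite subset_leq_card // subUset E1T.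
by rewrite T3 c1 c2; move: #|_| #|_| => s t; lia.
Qed.

Lemma edge_set_card k : #|edge_set (edge_of k)| = 2%N.
Proof. by have [i [j [ij ->]]] := edge_ends k; rewrite cards2 ij. Qed.

(** Images of two edges at i meet, since triangles go to triangles. If i v1 and i v2 go to {j, p}
    and {j, p'}, then v1 v2 goes to {p, p'}. Another edge at i whose image avoids j would also go to
    {p, p'}, against injectivity. *)
Lemma line_star_support A : lin_automorphism (Lvar 1 n) A ->
  forall i, exists j, forall v, v != i -> star_support j (A *m unit_edge C i v).
Proof.
move=> AL i; have [phi [r [phiI r0 AE tri]]] := edge_permutation AL.
pose E k := edge_set (edge_of (phi k)).
suff [j jE] : exists j, forall v k, v != i -> edge_set (edge_of k) = [set i; v] -> j \in E k.
  exists j => v vi; have iv : i != v by rewrite eq_sym.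
  have [k kE] := edge_indexP iv; rewrite (unit_edge_delta C kE) AE => a b aj bj.
  have := jE v k vi kE; rewrite /E; have [s [t [st sE]]] := edge_ends (phi k).
  rewrite sE -(unit_edge_delta C sE) coordZ coord_unit // pair_set_eq !inE => /orP[]/eqP<-.
    by rewrite (negbTE aj) (negbTE bj) andbF mulr0.
  by rewrite (negbTE aj) (negbTE bj) andbF mulr0.
have [|v1] := @other_vertex n [:: i]; first by rewrite /=; lia.
rewrite inE => v1i; have [|v2] := @other_vertex n [:: i; v1]; first by [].
rewrite !inE negb_or => /andP[v2i v21].
have iv1 : i != v1 by rewrite eq_sym.
have iv2 : i != v2 by rewrite eq_sym.
have v12 : v1 != v2 by rewrite eq_sym.
have [k1 k1E] := edge_indexP iv1; have [k2 k2E] := edge_indexP iv2.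
have [k3 k3E] := edge_indexP v12.
have Einj k l : E k = E l -> k = l by move=> ?; apply: phiI; apply: edge_set_inj.
have Ecard k : #|E k| = 2%N by apply: edge_set_card.
have inT v w k T : edge_set (edge_of k) = [set v; w] ->
    v \in T -> w \in T -> edge_set (edge_of k) \subset T.
  by move=> -> vT wT; apply/subsetP => a; rewrite !inE => /orP[]/eqP->.
have meet v w k l : uniq [:: i; v; w] -> edge_set (edge_of k) = [set i; v] ->
    edge_set (edge_of l) = [set i; w] -> exists j, j \in E k :&: E l.
  move=> ivw kE lE; have [T [q [T3 TE]]] := tri i v w ivw.
  have [|kT _] := TE k; first by apply: inT kE _ _; rewrite !inE eqxx ?orbT.
  have [|lT _] := TE l; first by apply: inT lE _ _; rewrite !inE eqxx ?orbT.
  exact: (two_subsets_meet T3 kT lT (Ecard _) (Ecard _)).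
have u12 : uniq [:: i; v1; v2] by rewrite /= !inE negb_or iv1 iv2 v12.
have [T [q [T3 TE]]] := tri i v1 v2 u12.
have [|k1T _] := TE k1; first by apply: inT k1E _ _; rewrite !inE eqxx ?orbT.
have [|k2T _] := TE k2; first by apply: inT k2E _ _; rewrite !inE eqxx ?orbT.
have [|k3T _] := TE k3; first by apply: inT k3E _ _; rewrite !inE eqxx ?orbT.
have [j] := meet v1 v2 k1 k2 u12 k1E k2E; rewrite inE => /andP[jk1 jk2].
have [p pj pE] := edge_other jk1; have [p' p'j p'E] := edge_other jk2.
have neq k l (a b a' b' : 'I_n) : edge_set (edge_of k) = [set a; b] ->
    edge_set (edge_of l) = [set a'; b'] -> [set a; b] != [set a'; b'] -> E k != E l.
  by move=> kE lE; apply: contraNneq => /Einj kl; rewrite -kE -lE kl.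
have E12 : E k1 != E k2.
  by apply: (neq _ _ _ _ _ _ k1E k2E); rewrite pair_set_eq eqxx (negbTE v12) (negbTE iv2).
have E13 : E k1 != E k3.
  by apply: (neq _ _ _ _ _ _ k1E k3E); rewrite pair_set_eq (negbTE iv1) (negbTE iv2).
have E23 : E k2 != E k3.
  by apply: (neq _ _ _ _ _ _ k2E k3E); rewrite pair_set_eq (negbTE iv1) (negbTE iv2).
have jk3 : j \notin E k3.
  apply/negP => jk3; have [t tj tE] := edge_other jk3.
  have pp' : p != p' by apply: contraNneq E12 => pp'; rewrite /E pE p'E pp'.
  have pt : p != t by apply: contraNneq E13 => pt; rewrite /E pE tE pt.
  have p't : p' != t by apply: contraNneq E23 => p't; rewrite /E p'E tE p't.
  have : (#|[:: j; p; p'; t]| <= #|T|)%N.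
    apply/subset_leq_card/subsetP => a; rewrite !inE => /or4P[]/eqP->.
    - by apply: (subsetP k1T).
    - by apply: (subsetP k1T); rewrite pE !inE eqxx orbT.
    - by apply: (subsetP k2T); rewrite p'E !inE eqxx orbT.
    - by apply: (subsetP k3T); rewrite tE !inE eqxx orbT.
  have /card_uniqP-> : uniq [:: j; p; p'; t]; last by rewrite T3.
  by rewrite /= !inE !negb_or ![j == _]eq_sym pj p'j tj pp' pt p't.
have jT : j \in T by apply: (subsetP k1T).
have E3 : E k3 = T :\ j.
  apply/eqP; rewrite eqEcard subsetD1 k3T jk3 Ecard /=.
  by move: T3; rewrite (cardsD1 j T) jT add1n => -[->].
have pk3 : p \in E k3.
  by rewrite E3 !inE pj (subsetP k1T) // pE !inE eqxx orbT.
have p'k3 : p' \in E k3.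
  by rewrite E3 !inE p'j (subsetP k2T) // p'E !inE eqxx orbT.
have pp' : p != p' by apply: contraNneq E12 => pp'; rewrite /E pE p'E pp'.
have E3' : E k3 = [set p; p'].
  by apply/esym/eqP; rewrite eqEcard subUset !sub1set pk3 p'k3 Ecard cards2 pp'.
exists j => v k vi kE; have iv : i != v by rewrite eq_sym.
have [vv1|vv1] := eqVneq v v1.
  by have -> : k = k1; [apply: edge_set_inj; rewrite /= kE k1E vv1|].
have [vv2|vv2] := eqVneq v v2.
  by have -> : k = k2; [apply: edge_set_inj; rewrite /= kE k2E vv2|].
apply: contraT => jk.
have pk : p \in E k.
  have [|m] := meet v v1 k k1 _ kE k1E.
    by rewrite /= !inE negb_or iv iv1 vv1.
  rewrite inE => /andP[mk mk']; have : m \in [set j; p] by rewrite -pE.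
  case/set2P=> mE; last by rewrite -mE.
  by rewrite -mE mk in jk.
have p'k : p' \in E k.
  have [|m] := meet v v2 k k2 _ kE k2E.
    by rewrite /= !inE negb_or iv iv2 vv2.
  rewrite inE => /andP[mk mk']; have : m \in [set j; p'] by rewrite -p'E.
  case/set2P=> mE; last by rewrite -mE.
  by rewrite -mE mk in jk.
have : E k != E k3.
  by apply: (neq _ _ _ _ _ _ kE k3E); rewrite pair_set_eq (negbTE iv1) (negbTE iv2).
rewrite E3' eq_sym; case/eqP; apply/eqP.
by rewrite eqEcard subUset !sub1set pk p'k Ecard cards2 pp'.
Qed.

Lemma line_automorphism A : lin_automorphism (Lvar 1 n) A ->
  exists (a : C) (S : 'M[C]_(nedges n)) (sigma : 'S_n),
    [/\ a != 0, is_diag_mx S, (forall k, S k k = 1 \/ S k k = -1) &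
        A = a *: (S *m edge_perm_mx sigma)].
Proof.
move=> AL; have [Au _] := AL.
have [sigma sI /= sE] := vertex_map n_ge3 Au (line_star_support AL)
  (line_star_support (lin_automorphism_inv AL)).
pose c i j := coord (A *m unit_edge C i j) (sigma i) (sigma j).
have AE i j : i != j -> c i j != 0 /\
    A *m unit_edge C i j = c i j *: unit_edge C (sigma i) (sigma j).
  move=> ij; have [c0 c00 c0E] := sE i j ij.
  by rewrite /c c0E coordZ coord_unitxx ?mulr1 // (inj_eq sI).
have c0 i j ij := (AE i j ij).1; have {}AE i j ij := (AE i j ij).2.
apply: (signed_permutation n_ge3 sI c0 AE) => i j v ij iv.
have [<-//|jv] := eqVneq j v.
have [phi [r [phiI r0 AD tri]]] := edge_permutation AL.
(* Comparing sums of squared coordinates relates c to r without identifying [phi k] with the edge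
   given by sigma. *)
pose norm2 (z : 'cV[C]_(nedges n)) := \sum_l z l 0 ^+ 2.
have normZ b l : norm2 (b *: delta_mx l 0) = b ^+ 2.
  rewrite /norm2 (bigD1 l) //= big1 ?addr0 => [|l' l'l].
    by rewrite !mxE !eqxx mulr1.
  by rewrite !mxE (negbTE l'l) mulr0 expr0n.
have cr u k : i != u -> edge_set (edge_of k) = [set i; u] -> c i u ^+ 2 = (r k) ^- 2.
  move=> iu kE; have siu : sigma i != sigma u by rewrite (inj_eq sI).
  have [l lE] := edge_indexP siu.
  have := congr1 norm2 (AE i u iu).
  by rewrite (unit_edge_delta C kE) AD (unit_edge_delta C lE) !normZ exprVn.
have [k kE] := edge_indexP ij; have [l lE] := edge_indexP iv.
rewrite (cr j k) // (cr v l) //.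
have [|T [q [_ TE]]] := tri i j v; first by rewrite /= !inE negb_or ij iv jv.
have [|_ ->] := TE k; first by rewrite kE subsetUl.
have [|_ ->] := TE l => //.
by rewrite lE; apply/subsetP => a; rewrite !inE => /orP[]->; rewrite ?orbT.
Qed.

End LineAutomorphisms.

Theorem theorem1p1 (R : realType) (d n : nat) :
  (1 <= d)%N -> (d + 2 <= n)%N -> (d, n) <> (2%N, 4%N) ->
  forall A : 'M[R[i]]_(nedges n),
    lin_automorphism (Lvar (C := R[i]) d n) A ->
    exists (c : R[i]) (S : 'M[R[i]]_(nedges n)) (sigma : 'S_n),
      [/\ c != 0,
          is_diag_mx S,
          (forall k, S k k = 1 \/ S k k = -1) &
          A = c *: (S *m edge_perm_mx sigma)].

Proof.
move=> d1 dn dn24 A AL; have [d2|d2] := ltnP 1 d; last first.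
  have dE : d = 1%N by lia.
  rewrite dE in dn AL; exact: (line_automorphism dn AL).
(* Here n >= d + 2 >= 4, with n = 4 only for d = 2, the excluded pair. *)
have n5 : (4 < n)%N.
  rewrite ltn_neqAle; apply/andP; split; last by lia.
  by apply/eqP => n4; apply: dn24; congr (_, _); lia.
exact: (Lvar_automorphism n5 d2 dn AL).
Qed.
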